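(* Let $\mathcal{H}=L^2([0,1])$, let $\{\varepsilon_k\}_{k\in\mathbb{Z}}$ be i.i.d. random functions in $\mathcal{H}$, let $\delta\in\mathcal{H}^+$, and let $\beta:\mathcal{H}^+\to\mathcal{H}^+$ be a non-negative operator given by a kernel, $\beta(x)(t)=\int\beta(t,s)x(s)\,ds$, $x\in\mathcal{H}$, such that the operator $\beta$ is bounded. Let $\{y_k\}$ be the functional ARCH(1) process in $\mathcal{H}$ given by $$y_k=\varepsilon_k\sigma_k,\qquad \sigma_k^2=\delta+\beta(y_{k-1}^2),\qquad k\in\mathbb{Z}.$$ Define $$K(\varepsilon_1^2)=\Big(\int\int\beta^2(t,s)\,\varepsilon_1^4(s)\,ds\,dt\Big)^{1/2}.$$ If there is some $\alpha>0$ such that $E\{K(\varepsilon_1^2)\}^\alpha<1$, then the two equations above have a unique strictly stationary solution in $\mathcal{H}$. Furthermore, $\sigma_k^2$ is of the form $$\sigma_k^2=g(\varepsilon_{k-1},\varepsilon_{k-2},\ldots),$$ with some measurable functional $g:\mathcal{H}^{\mathbb{N}}\to\mathcal{H}$.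
   Context: All integrals are over $[0,1]$. $\mathcal{H}=L^2([0,1])$ is the Hilbert space of square integrable real functions on $[0,1]$ with norm $\|x\|_{\mathcal{H}}=(\int x^2(s)\,ds)^{1/2}$; $\mathcal{H}^+$ is the set of non-negative functions in $\mathcal{H}$. Products, squares and square roots of functions are pointwise. The same symbol $\beta$ denotes the kernel and the operator. A functional ARCH(1) process in $\mathcal{H}$ is an $\mathcal{H}$-valued process $\{y_k(s),\,k\in\mathbb{Z},\,s\in[0,1]\}$ satisfying the two displayed equations.
   Formalization: Existence of a stationary y_k in H is asserted when some process in H satisfies the two equations (otherwise false: β=0, ε_k(s)=δ(s)=s^{-1/3}); existence, uniqueness, stationarity and the form g(ε_{k-1},…) of σ_k^2 in H are unconditional. *)

(* Defs.v *)
From HB Require Import structures.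
From mathcomp Require Import all_boot all_order all_algebra.
From mathcomp Require Import all_classical all_reals all_analysis.
From mathcomp Require Import measurable_realfun.

Set Implicit Arguments.
Unset Strict Implicit.
Unset Printing Implicit Defensive.

Import Order.TTheory GRing.Theory Num.Theory.
Import numFieldNormedType.Exports.
Local Open Scope classical_set_scope.
Local Open Scope ring_scope.

(* Lebesgue measure on [0,1], carried by the type of all real numbers: values
   of functions and kernels outside [0,1] are irrelevant. *)
Definition leb01 (R : realType) : {measure set (measurableTypeR R) -> \bar R} :=
  mrestr lebesgue_measure (@measurable_itv R `[0, 1]).

(* Elements are classes for a.e. equality; the coercion to functions picks a
   representative, so they should only be compared almost everywhere. *)
Definition L2 (R : realType) : Type := LspaceType2 (leb01 R).

Definition L2_fun (R : realType) (x : L2 R) : R -> R :=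
  aqEqMfun_to_fun (LebesgueSpace.sort x).
Coercion L2_fun : L2 >-> Funclass.

Definition L2_dist (R : realType) (x y : L2 R) : \bar R :=
  Lnorm (leb01 R) 2%:E (fun s => (x s - y s)%:E).

Definition L2_open (R : realType) : set (set (L2 R)) :=
  [set A | forall x, A x ->
     exists2 r : R, 0 < r & forall y, (L2_dist x y < r%:E)%E -> A y].

Section L2_measurable.
Variable R : realType.

Let zero_class : {mfun_ (leb01 R), measurableTypeR R >-> measurableTypeR R} :=
  \pi_({mfun_ (leb01 R), measurableTypeR R >-> measurableTypeR R})%qT
    (cst 0 : {mfun measurableTypeR R >-> measurableTypeR R}).

Let zero_class_finite : finite_norm (leb01 R) 2%:R%:E zero_class.
Proof.
have /eqmodP/asboolP h := reprK zero_class.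
rewrite /finite_norm unlock (_ : (\int[_]_x _)%E = 0%E).
  by rewrite poweR0r// invr_neq0.
rewrite -[RHS](integral0 (leb01 R) setT).
apply: ae_eq_integral => //.
- apply: (measurableT_comp (measurable_poweR _)) => //.
  apply: measurableT_comp => //; apply/measurable_EFinP.
  exact: (@measurable_funPT _ _ _ _ (repr zero_class)).
- apply: filterS h => x /(_ I) hx _ /=.
  by rewrite /aqEqMfun_to_fun hx /= normr0 powR0.
Qed.

Let zero_L2 : L2 R :=
  LebesgueSpace.Pack (LebesgueSpace.Class
    (isFinLebesgue.Build _ _ _ (leb01 R) _ (lee1n 2) zero_class
      zero_class_finite)).

HB.instance Definition _ := gen_eqMixin (L2 R).
HB.instance Definition _ := gen_choiceMixin (L2 R).
HB.instance Definition _ := isPointed.Build (L2 R) zero_L2.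
HB.instance Definition _ := @isMeasurable.Build (sigma_display (@L2_open R))
  (L2 R) <<s (@L2_open R) >> (@sigma_algebra0 _ setT (@L2_open R))
  (@sigma_algebraC _ (@L2_open R)) (@sigma_algebra_bigcup _ setT (@L2_open R)).

End L2_measurable.

Definition L2_nonneg (R : realType) (x : L2 R) : Prop :=
  {ae leb01 R, forall s, 0 <= x s}.

(* Generators of the product sigma-algebra of X^I. *)
Definition cylinders (I : Type) (d : measure_display) (X : measurableType d) :
    set (set (I -> X)) :=
  [set C | exists (i : I) (A : set X),
     measurable A /\ C = [set f : I -> X | A (f i)]].

Definition measurable_functional (I : Type) (d d' : measure_display)
    (X : measurableType d) (Y : measurableType d') (g : (I -> X) -> Y) : Prop :=
  forall B : set Y, measurable B -> <<s @cylinders I d X >> (g @^-1` B).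

Section processes.
Context (R : realType) (d : measure_display) (T : measurableType d)
  (P : probability T R) (d' : measure_display) (X : measurableType d').

Definition iid (e : int -> T -> X) : Prop :=
  [/\ forall k, measurable_fun setT (e k),
      forall k (A : set X), measurable A -> P (e k @^-1` A) = P (e 0 @^-1` A)
    & forall (J : seq int) (A : int -> set X), uniq J ->
        (forall k, measurable (A k)) ->
        P (\big[setI/setT]_(k <- J) (e k @^-1` A k)) =
        \big[*%E/1%E]_(k <- J) P (e k @^-1` A k)].

(* All time shifts of the process have the same law on X^Z. *)
Definition strictly_stationary (y : int -> T -> X) : Prop :=
  forall (h : int) (C : set (int -> X)), <<s @cylinders int d' X >> C ->
    P [set w | C (fun k => y (k + h) w)] = P [set w | C (fun k => y k w)].

End processes.

Section kernels.
Variable R : realType.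
Implicit Types (b : R -> R -> R) (x : R -> R).

Definition kernel_op b x (t : R) : \bar R :=
  (\int[leb01 R]_s (b t s * x s)%:E)%E.

Definition bounded_kernel_op b : Prop :=
  measurable_fun setT (fun ts : measurableTypeR R * measurableTypeR R =>
                         b ts.1 ts.2 : measurableTypeR R) /\
  exists M : R, forall x : L2 R,
    {ae leb01 R, forall t,
       (leb01 R).-integrable setT (fun s => (b t s * x s)%:E)} /\
    (Lnorm (leb01 R) 2%:E (kernel_op b x) <=
     M%:E * Lnorm (leb01 R) 2%:E (EFin \o x))%E.

Definition nonneg_kernel_op b : Prop :=
  forall x : L2 R, L2_nonneg x ->
    {ae leb01 R, forall t, (0 <= kernel_op b x t)%E}.

(* [arch_K b x] is K(x^2). *)
Definition arch_K b x : \bar R :=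
  ((\int[leb01 R]_t \int[leb01 R]_s (b t s ^+ 2 * x s ^+ 4)%:E) `^ 2^-1)%E.

End kernels.

Section arch.
Context (R : realType) (d : measure_display) (T : measurableType d)
  (P : probability T R) (eps : int -> T -> L2 R) (delta : L2 R)
  (b : R -> R -> R).

(* [v k] stands for sigma_k^2. The square of y_(k-1) need not be in L2, so
   beta (y_(k-1)^2) is the Lebesgue integral against the kernel; the second
   equation forces it to be finite almost everywhere. *)
Definition arch1_eqs (y : int -> T -> R -> R) (v : int -> T -> L2 R) : Prop :=
  forall k, {ae P, forall w,
    [/\ L2_nonneg (v k w),
        {ae leb01 R, forall s, y k w s = eps k w s * Num.sqrt (v k w s)} &
        {ae leb01 R, forall t, (v k w t)%:E =
           ((delta t)%:E + kernel_op b (fun s => y (k - 1)%R w s ^+ 2)%R t)%E}]}.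

Definition functional_ARCH1 (y v : int -> T -> L2 R) : Prop :=
  [/\ forall k, measurable_fun setT (y k), forall k, measurable_fun setT (v k)
    & arch1_eqs (fun k w => y k w) v].

(* The equations with only sigma_k^2 in L2: y_k = eps_k sigma_k is merely a
   measurable function on [0,1]. *)
Definition volatility_ARCH1 (v : int -> T -> L2 R) : Prop :=
  (forall k, measurable_fun setT (v k)) /\
  arch1_eqs (fun k w s => eps k w s * Num.sqrt (v k w s)) v.

End arch.

(* Main.v *)
Require Import Defs.
From HB Require Import structures.
From mathcomp Require Import all_boot all_order all_algebra.
From mathcomp Require Import all_classical all_reals all_analysis.
From mathcomp Require Import measurable_realfun.
From mathcomp Require Import ring lra zify.

Import Order.TTheory GRing.Theory Num.Theory.
Import numFieldNormedType.Exports.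
Local Open Scope classical_set_scope.
Local Open Scope ring_scope.

Set Implicit Arguments.
Unset Strict Implicit.
Unset Printing Implicit Defensive.

(** The kernel is non-negative almost everywhere, so all integrals may be taken in
[[0, +oo]] and the iterates [sigma^2_n = delta + beta (eps^2 sigma^2_(n-1))],
started at [0] in the distant past, increase pointwise to a minimal solution,
which is a functional of the past noise. By Cauchy-Schwarz the operator
[u |-> beta (eps_k^2 u)] has norm at most [K_k = K (eps_k^2)], hence the norm of
the limit is at most [|delta|] times the sum of the products
[K_(k-1) ... K_(k-n)]. By independence these products have [alpha]-moment
[rho^n] with [rho < 1], so they decay geometrically almost surely.

Any other solution dominates the minimal one, and the difference at time [k] is
at most [K_(k-1) ... K_(k-n)] times the norm of that solution at time [k - n].
The first factor tends to [0] in probability and the second one is tight by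
stationarity. Domination also shows that [eps_k sigma_k] is in [L2] as soon as
the equations have some solution with [y_k] in [L2].

Measurability rests on the separability of [L2] (dyadic step functions are
dense, by Lebesgue differentiation): it yields a jointly measurable evaluation
map [L2 * R -> R], and reduces Borel measurability into [L2] to measurability
of real integrals. *)

(** Three obstacles shape the development. Since [sigma_k^2] lies in L2, [sigma_k] lies in L4, while
    [eps_k] is only in L2: the product [eps_k sigma_k] may leave L2, because [K] weighs [eps_k^4] by
    the kernel alone. Hence existence is proved for [sigma^2], and the claim about [y_k] in L2 is
    conditional on some solution of that kind. For the same reason the norm bound of beta says
    nothing about [beta (y^2)]; boundedness acts through the integrability of the sections of the
    kernel, which opens the way to Lebesgue differentiation. An element of L2 is a class whose
    representative is picked by choice, so evaluating a random element at [t] need not be jointly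
    measurable. [L2_eval] replaces the representative wherever the sample point varies. The two
    uniqueness claims assume stationarity of different processes, [sigma^2] or [y]. Both are reduced
    to one fact: the law of the norm of [sigma_k^2] does not depend on [k]. All almost sure
    information on the noise is gathered in [good_path]; the estimates themselves are deterministic,
    for one noise sequence. *)

Section leb01.
Variable R : realType.

Lemma leb01E (A : set R) : leb01 R A = lebesgue_measure (A `&` `[0, 1]).
Proof. by []. Qed.

Lemma leb01_setT : leb01 R setT = 1%E.
Proof. by rewrite leb01E setTI lebesgue_measure_itv/= lte_fin ltr01 sube0. Qed.

Lemma leb01_fin : fin_num_fun (leb01 R).
Proof.
apply: lty_fin_num_fun; rewrite leb01_setT; exact: ltry.
Qed.

(** A second name of the measure that carries its finiteness, which Tonelli's theorem asks for. *)
Definition leb01_finite : set (measurableTypeR R) -> \bar R := leb01 R.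
HB.instance Definition _ := Measure.on leb01_finite.
HB.instance Definition _ := Measure_isFinite.Build _ _ _ leb01_finite leb01_fin.

Lemma measurable_integral01 (d : measure_display) (T : measurableType d)
    (f : T * measurableTypeR R -> \bar R) :
  measurable_fun setT f -> (forall x, 0 <= f x)%E ->
  measurable_fun setT (fun x => \int[leb01 R]_s f (x, s))%E.
Proof.
move=> mf f0; exact: (@measurable_fun_fubini_tonelli_F _ _ _ _ _ leb01_finite f).
Qed.

Lemma ae01S (Q S : R -> Prop) : (forall t, Q t -> S t) ->
  {ae leb01 R, forall t, Q t} -> {ae leb01 R, forall t, S t}.
Proof.
by move=> QS; exact: (@filterS (measurableTypeR R) (almost_everywhere (leb01 R))).
Qed.

Lemma ae01S2 (Q1 Q2 S : R -> Prop) : (forall t, Q1 t -> Q2 t -> S t) ->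
  {ae leb01 R, forall t, Q1 t} -> {ae leb01 R, forall t, Q2 t} ->
  {ae leb01 R, forall t, S t}.
Proof.
by move=> QS; exact: (@filterS2 (measurableTypeR R) (almost_everywhere (leb01 R))).
Qed.

Lemma ae01S3 (Q1 Q2 Q3 S : R -> Prop) :
  (forall t, Q1 t -> Q2 t -> Q3 t -> S t) ->
  {ae leb01 R, forall t, Q1 t} -> {ae leb01 R, forall t, Q2 t} ->
  {ae leb01 R, forall t, Q3 t} -> {ae leb01 R, forall t, S t}.
Proof.
by move=> QS; exact: (@filterS3 (measurableTypeR R) (almost_everywhere (leb01 R))).
Qed.

Lemma ae01_eq_integral (f g : R -> \bar R) :
  measurable_fun setT f -> measurable_fun setT g ->
  {ae leb01 R, forall t, f t = g t} ->
  (\int[leb01 R]_t f t = \int[leb01 R]_t g t)%E.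
Proof.
by move=> mf mg fg; apply: ae_eq_integral => //; apply: ae01S fg.
Qed.

Lemma ae_leb01 (Q : R -> Prop) :
  {ae leb01 R, forall t, Q t} <->
  {ae lebesgue_measure, forall t, `[0%R, 1%R]%classic t -> Q t}.
Proof.
split=> -[N [mN N0 QN]].
  exists (N `&` `[0%R, 1%R]); split => //; first exact: measurableI.
  by move=> t /= /not_implyP[t01 nQ]; split => //; exact: QN.
exists (N `|` ~` `[0%R, 1%R]); split.
- by apply: measurableU => //; exact: measurableC.
- rewrite leb01E setIUl setICl setU0.
  apply/eqP; rewrite -measure_le0 -N0 le_measure ?inE//=.
  exact: measurableI.
- move=> t /= nQ; have [t01|] := pselect (`[0%R, 1%R]%classic t); last by right.
  by left; apply: QN => /= /(_ t01).
Qed.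

Lemma ae_leb01_itv : {ae leb01 R, forall t, `[0%R, 1%R]%classic t}.
Proof. exact/ae_leb01/aeW. Qed.

Lemma integral_leb01 (f : R -> \bar R) : measurable_fun setT f ->
  (\int[leb01 R]_x f x = \int[lebesgue_measure]_(x in `[0%R, 1%R]) f x)%E.
Proof.
move=> mf.
have mD : measurable (`[0%R, 1%R]%classic : set R) by exact: measurable_itv.
transitivity (\int[leb01 R]_(x in `[0%R, 1%R]) f x)%E.
  rewrite [RHS]integral_mkcond; apply: ae01_eq_integral => //.
    by apply/(measurable_restrictT _ mD); exact: measurable_funTS.
  by apply: ae01S ae_leb01_itv => x x01; rewrite patchT// inE.
apply: eq_measure_integral => A mA AD.
by rewrite leb01E; congr lebesgue_measure; exact/setIidl.
Qed.

Lemma measurable_L2 (x : L2 R) : measurable_fun setT (x : R -> R).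
Proof.
exact: (@measurable_funPT _ _ _ _ (repr (LebesgueSpace.sort x))).
Qed.

Lemma Lnorm2_EFin (f : R -> R) : Lnorm (leb01 R) 2%:E (EFin \o f) =
  ((\int[leb01 R]_t ((f t) ^+ 2)%:E) `^ 2^-1)%E.
Proof.
rewrite unlock; congr (_ `^ _)%E; apply: eq_integral => t _ /=.
by rewrite -[2%R]/(2%:R) powR_mulrn// real_normK// num_real.
Qed.

Lemma finite_L2 (x : L2 R) : (\int[leb01 R]_t ((x t) ^+ 2)%:E < +oo)%E.
Proof.
have : (Lnorm (leb01 R) 2%:E (EFin \o x) < +oo)%E := @Lebesgue_finite _ _ _ _ _ _ x.
rewrite Lnorm2_EFin.
by apply: lty_poweRy; rewrite invr_neq0.
Qed.

(** An element is a quotient class packed with a proof of finite norm, and proofs are irrelevant.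
    Uniqueness can thus be concluded as plain equality in [L2 R]. *)
Lemma L2_ext (x y : L2 R) : {ae leb01 R, forall t, x t = y t} -> x = y.
Proof.
move=> h.
have e : LebesgueSpace.sort x = LebesgueSpace.sort y.
  rewrite -[LHS]reprK -[RHS]reprK; apply/eqmodP/asboolP.
  by apply: ae01S h.
case: x y e {h} => x [[cx]] [y [[cy]]] /= e; subst y.
by rewrite (Prop_irrelevance cx cy).
Qed.

Lemma L2_ex (f : R -> R) : measurable_fun setT f ->
  (\int[leb01 R]_t ((f t) ^+ 2)%:E < +oo)%E ->
  exists x : L2 R, {ae leb01 R, forall t, x t = f t}.
Proof.
move=> mf fi.
have mf' : (f : measurableTypeR R -> measurableTypeR R) \in mfun by rewrite inE.
pose F : {mfun measurableTypeR R >-> measurableTypeR R} := mfun_Sub mf'.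
pose c : {mfun_ (leb01 R), measurableTypeR R >-> measurableTypeR R} :=
  \pi_({mfun_ (leb01 R), measurableTypeR R >-> measurableTypeR R})%qT F.
have cf : {ae leb01 R, forall t, aqEqMfun_to_fun c t = f t}.
  have /eqmodP/asboolP h := reprK c.
  by apply: ae01S h => t /(_ I).
have cfin : finite_norm (leb01 R) 2%:R%:E c.
  rewrite /finite_norm -[2%:R]/2 Lnorm2_EFin.
  rewrite (@ae01_eq_integral _ (fun t => (f t ^+ 2)%:E))//.
  - exact: poweR_lty.
  - apply/measurable_EFinP; apply: measurable_funX.
    exact: (@measurable_funPT _ _ _ _ (repr c)).
  - by apply/measurable_EFinP; apply: measurable_funX.
  - by apply: ae01S cf => t ->.
by exists (LebesgueSpace.Pack (LebesgueSpace.Class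
    (isFinLebesgue.Build _ _ _ (leb01 R) _ (lee1n 2) c cfin))).
Qed.

Lemma L2_distE (x y : L2 R) :
  (L2_dist x y = (\int[leb01 R]_t ((x t - y t) ^+ 2)%:E) `^ 2^-1)%E.
Proof. exact: (Lnorm2_EFin (fun t => x t - y t)). Qed.

End leb01.

(** * Dyadic cells and Lebesgue differentiation *)

Lemma measurable_fun_nat (d : measure_display) (T : measurableType d)
    (f : T -> nat) : (forall n, measurable (f @^-1` [set n])) ->
  measurable_fun setT f.
Proof.
move=> mf _ B _; rewrite setTI.
rewrite (_ : f @^-1` B = \bigcup_(n in B) (f @^-1` [set n])).
  exact: bigcup_measurable.
apply/seteqP; split=> [t Bt|t [n Bn /= ftn]]; first by exists (f t).
by rewrite /preimage/= ftn.
Qed.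

Section dyadic.
Variable R : realType.
Implicit Types (n : nat) (m : int) (t : R).

Definition dyadic_index n t : int := Num.floor (t * 2 ^+ n).

Definition dyadic_cell n m : set R := [set t | dyadic_index n t = m].

Lemma dyadic_cellE n m : dyadic_cell n m =
  [set` `[m%:~R / 2 ^+ n, (m + 1)%:~R / 2 ^+ n[].
Proof.
apply/seteqP; split=> t; rewrite /dyadic_cell/= in_itv/= ler_pdivrMr ?exprn_gt0//
  ltr_pdivlMr ?exprn_gt0//.
- by move=> /eqP; rewrite floor_eq.
- by move=> h; apply/eqP; rewrite floor_eq.
Qed.

Lemma measurable_dyadic_cell n m : measurable (dyadic_cell n m).
Proof. by rewrite dyadic_cellE; exact: measurable_itv. Qed.

Lemma lebesgue_measure_dyadic_cell n m :
  lebesgue_measure (dyadic_cell n m) = ((2 ^+ n)^-1)%:E.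
Proof.
have lt2 : m%:~R / 2 ^+ n < (m + 1)%:~R / 2 ^+ n :> R.
  by rewrite ltr_pM2r ?invr_gt0 ?exprn_gt0// ltr_int ltrDl.
rewrite dyadic_cellE lebesgue_measure_itv/= lte_fin lt2 -EFinB -mulrBl.
by rewrite intrD addrAC subrr add0r mul1r.
Qed.

Lemma nicely_shrinking_dyadic_cell t :
  nicely_shrinking t (fun n => dyadic_cell n (dyadic_index n t)).
Proof.
split=> [n|]; first exact: measurable_dyadic_cell.
have p n : 0 < 2 * (2 ^+ n)^-1 :> R by rewrite mulr_gt0// invr_gt0 exprn_gt0.
(* The ball of radius [2 * 2^-n] has length [4 * 2^-n], four times that of the cell. *)
exists (4, fun n => PosNum (p n)); split => //=.
- rewrite -[X in _ --> X](mulr0 2); apply: cvgM; first exact: cvg_cst.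
  under eq_fun do rewrite -exprVn.
  apply: cvg_expr; rewrite ger0_norm ?invr_ge0//.
  by rewrite invf_lt1// ltr1n.
- move=> n y; rewrite /ball/= => /eqP.
  rewrite floor_eq => /andP[h1 h2].
  have := floor_itv (t * 2 ^+ n); rewrite -/(dyadic_index n t) => /andP[h3 h4].
  rewrite intrD in h2 h4.
  have h : `|t * 2 ^+ n - y * 2 ^+ n| < 1 by rewrite ltr_norml; lra.
  rewrite -mulrBl normrM [X in _ * X]ger0_norm ?exprn_ge0// in h.
  rewrite -ltr_pdivlMr ?exprn_gt0// in h.
  apply: (lt_trans h); rewrite ltr_pM2r ?invr_gt0 ?exprn_gt0//; lra.
- move=> n; rewrite lebesgue_measure_ball//= lebesgue_measure_dyadic_cell.
  rewrite -EFinM lee_fin; have := p n; lra.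
Qed.

Lemma measurable_dyadic_index n :
  measurable_fun setT (fun t => `|dyadic_index n t|%N).
Proof.
apply: measurable_fun_nat => k.
rewrite (_ : _ @^-1` _ = dyadic_cell n k%:Z `|` dyadic_cell n (- k%:Z)).
  by apply: measurableU; exact: measurable_dyadic_cell.
apply/seteqP; split=> t /=; rewrite /dyadic_cell/=.
  by move=> <-; case: (dyadic_index n t) => j; [left|right].
by move=> [->|->]; rewrite ?abszN.
Qed.

Lemma integral_leb01_cell (f : R -> R) (E : set R) : measurable E ->
  measurable_fun setT f ->
  (\int[leb01 R]_(s in E) (f s)%:E =
   \int[lebesgue_measure]_(s in E) ((f \_ `[0%R, 1%R]) s)%:E)%E.
Proof.
move=> mE mf; rewrite [LHS]integral_mkcond integral_leb01; last first.
  apply/(measurable_restrictT _ mE); apply: measurable_funTS.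
  exact/measurable_EFinP.
rewrite [LHS]integral_mkcond [RHS]integral_mkcond.
apply: eq_integral => s _; rewrite /patch.
by case: ifP => // h1; case: ifP.
Qed.

(** The factor [2 ^+ n] is the inverse of the full length of the cell, although the integral only
    sees its part in [0,1]. This is Lebesgue differentiation of [f] cut off outside [0,1]. *)
Lemma dyadic_differentiation (f : R -> R) :
  (leb01 R).-integrable setT (EFin \o f) ->
  {ae leb01 R, forall t, ((2 ^+ n)%:E *
     \int[leb01 R]_(s in dyadic_cell n (dyadic_index n t)) (f s)%:E)%E
     @[n --> \oo] --> (f t)%:E}.
Proof.
move=> /integrableP[/measurable_EFinP mf fi].
have mD : measurable (`[0%R, 1%R]%classic : set R) by exact: measurable_itv.
have intf : lebesgue_measure.-integrable `[0%R, 1%R] (EFin \o f).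
  apply/integrableP; split.
    by apply/measurable_EFinP; exact: measurable_funTS.
  by rewrite -integral_leb01//; exact/measurableT_comp/measurable_EFinP.
have locf := integrable_locally_restrict mD intf.
have := lebesgue_differentiation locf.
move=> ae_pt; apply/ae_leb01.
apply: (@filterS _ _ (ae_filter_ringOfSetsType lebesgue_measure) _ _ _ ae_pt).
move=> t h t01.
have := nice_lebesgue_differentiation nicely_shrinking_dyadic_cell locf h.
rewrite {2}/patch ifT ?inE//.
apply: cvg_trans; apply: near_eq_cvg; apply: nearW => n /=.
rewrite lebesgue_measure_dyadic_cell integral_leb01_cell//; last first.
  exact: measurable_dyadic_cell.
by rewrite inver invr_eq0 expf_eq0 pnatr_eq0 andbF invrK.
Qed.

(** Countably many test sets detect the sign of [f]. Applied to the sections of the kernel, this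
    allows one exceptional null set of [t] for all tests together. *)
Lemma ae_ge0_dyadic (f : R -> R) :
  (leb01 R).-integrable setT (EFin \o f) ->
  (forall n m, 0 <= \int[leb01 R]_(s in dyadic_cell n m) (f s)%:E)%E ->
  {ae leb01 R, forall t, 0 <= f t}.
Proof.
move=> fi f0; apply: ae01S (dyadic_differentiation fi) => t h.
rewrite -lee_fin -(cvg_lim _ h)//; apply: lime_ge.
  by apply/cvg_ex; exists (f t)%:E.
by apply: nearW => n; rewrite mule_ge0// lee_fin exprn_ge0.
Qed.

End dyadic.

(** * Separability of L2 and joint evaluation *)

Lemma cvge_near_lt (R : realType) (u : (\bar R)^nat) (l e : \bar R) :
  u @ \oo --> l -> (l < e)%E -> exists n, (u n < e)%E.
Proof.
move=> ul le.
have h : nbhs l [set y | (y < e)%E].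
  by apply: open_nbhs_nbhs; split => //; exact: open_ereal_lt_ereal.
by have [N _ /(_ N (leqnn N))] := ul _ h; exists N.
Qed.

Lemma ae_lty (d : measure_display) (T : measurableType d) (R : realType)
    (mu : {measure set T -> \bar R}) (f : T -> \bar R) :
  measurable_fun setT f -> (forall x, 0 <= f x)%E -> (\int[mu]_x f x < +oo)%E ->
  {ae mu, forall x, (f x < +oo)%E}.
Proof.
move=> mf f0 fi.
have : mu.-integrable setT f.
  apply/integrableP; split => //.
  by under eq_integral do rewrite gee0_abs//.
move=> /(integrable_ae measurableT); apply: filterS => x /(_ I).
by rewrite ge0_fin_numE.
Qed.

(** A term is at most the tail that starts with it, and the tails of a finite sum vanish. *)
Lemma nneseries_cvg0 (R : realType) (u : (\bar R)^nat) :
  (forall n, 0 <= u n)%E -> (\sum_(n <oo) u n < +oo)%E -> u @ \oo --> 0%E.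
Proof.
move=> u0 us.
have := nneseries_tail_cvg us (fun n _ => u0 n).
apply: (@squeeze_cvge _ _ _ _ (cst 0%E)); last exact: cvg_cst.
apply: nearW => n; rewrite u0/= (@nneseries_split _ _ n 1)//.
  by rewrite addn1 big_nat1 leeDl// nneseries_ge0.
Qed.

Section step.
Variable R : realType.

Lemma leb01_integrable_cst (k : R) : (leb01 R).-integrable setT (cst k%:E).
Proof.
apply/integrableP; split; first exact: measurable_cst.
rewrite (_ : (fun x => _) = cst `|k|%:E)//.
by rewrite integral_cst// leb01_setT mule1 ltry.
Qed.

(** The number [p.1] is both the level of the cells and the precision of the values, so the codes
    [p] form a countable type. Taking the absolute value of the index is harmless: negative indices
    only occur outside [0,1]. *)
Definition step_fun (p : nat * seq int) (t : R) : R :=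
  (nth 0 p.2 `|dyadic_index p.1 t|%N)%:~R / p.1.+1%:R.

Lemma measurable_step_fun p : measurable_fun setT (step_fun p).
Proof.
apply: (measurableT_comp (f := fun k : nat => (nth 0 p.2 k)%:~R / p.1.+1%:R : R)).
  by [].
exact: measurable_dyadic_index.
Qed.

Lemma step_fun_sq_lty p : (\int[leb01 R]_t (step_fun p t ^+ 2)%:E < +oo)%E.
Proof.
have [B hB] : exists B : R, forall k, `|(nth 0 p.2 k)%:~R| <= B.
  case: p => n /=; elim => [|z s [B IH]].
    by exists 0 => k; rewrite nth_nil normr0.
  exists (`|z%:~R| + B) => -[|k] /=.
    by rewrite lerDl (le_trans _ (IH 0%N)).
  by apply: le_trans (IH k) _; rewrite lerDr.
apply: (@le_lt_trans _ _ (\int[leb01 R]_t (cst ((B / p.1.+1%:R) ^+ 2)%:E t))%E).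
  apply: ge0_le_integral => //.
  - by move=> t _; rewrite lee_fin sqr_ge0.
  - by apply/measurable_EFinP/measurable_funX; exact: measurable_step_fun.
  - move=> t _; rewrite lee_fin -[X in X <= _](real_normK (num_real _)).
    have B0 : 0 <= B by apply: le_trans (hB 0%N).
    rewrite lerXn2r ?nnegrE// ?divr_ge0// /step_fun normrM.
    by rewrite [X in _ * X]ger0_norm ?invr_ge0// ler_wpM2r ?invr_ge0.
by rewrite integral_cst// leb01_setT mule1 ltry.
Qed.

(** Average [x] over the cells of level [n], then round to a multiple of [1/(n+1)]. The averages
    converge almost everywhere by differentiation, and the bound [M] allows dominated convergence of
    the squared error. *)
Lemma step_dense_bounded (x : R -> R) (M e : R) : measurable_fun setT x ->
  (forall t, `|x t| <= M) -> 0 < e ->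
  exists p, (\int[leb01 R]_t ((x t - step_fun p t) ^+ 2)%:E < e%:E)%E.
Proof.
move=> mx xM e0.
have M0 : 0 <= M by apply: le_trans (xM 0).
have ix : (leb01 R).-integrable setT (EFin \o x).
  apply: measurable_bounded_integrable => //=.
    by rewrite leb01_setT ltry.
  by exists M; split; [exact: num_real|move=> y My t _ /=; apply: le_trans (ltW My)].
pose c n m := fine ((2 ^+ n)%:E * \int[leb01 R]_(s in dyadic_cell n m) (x s)%:E)%E.
have cM n m : (`|(2 ^+ n)%:E * \int[leb01 R]_(s in @dyadic_cell R n m) (x s)%:E| <= M%:E)%E.
  rewrite abseM gee0_abs ?lee_fin ?exprn_ge0//.
  rewrite -lee_pdivlMl ?exprn_gt0//.
  apply: le_trans (le_abse_integral _ _ _) _ => //.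
  - exact: measurable_dyadic_cell.
  - by apply/measurable_EFinP; exact: measurable_funTS.
  apply: le_trans (@integral_le_bound _ _ _ _ _ _ M%:E _ _ _ _) _ => //.
  - exact: measurable_dyadic_cell.
  - by apply/measurable_EFinP; exact: measurable_funTS.
  - by apply: aeW => t _ /=; rewrite lee_fin.
  rewrite muleC; apply: lee_wpmul2r; first by rewrite lee_fin.
  rewrite -(lebesgue_measure_dyadic_cell R n m) leb01E le_measure ?inE//.
  - by apply: measurableI; [exact: measurable_dyadic_cell|exact: measurable_itv].
  - exact: measurable_dyadic_cell.
have cE n m : (c n m)%:E = ((2 ^+ n)%:E * \int[leb01 R]_(s in dyadic_cell n m) (x s)%:E)%E.
  rewrite fineK// fin_num_abs.
  exact: le_lt_trans (cM n m) (ltry _).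
have {}cM n m : `|c n m| <= M by rewrite -lee_fin -abse_EFin cE.
(* On [0,1] the indices run from 0 to [2 ^ n], the last one for [t = 1]; hence [(2 ^ n).+1]
   entries. *)
pose s n := mkseq (fun j => Num.floor (n.+1%:R * c n j%:Z)) (2 ^ n).+1.
have near n (t : R) : `[0%R, 1%R]%classic t ->
    `|c n (dyadic_index n t) - step_fun (n, s n) t| <= n.+1%:R^-1.
  rewrite /= in_itv/= => /andP[t0 t1].
  have i0 : 0 <= dyadic_index n t by rewrite floor_ge0 mulr_ge0// exprn_ge0.
  have i1 : (`|dyadic_index n t| < (2 ^ n).+1)%N.
    rewrite ltnS -lez_nat gez0_abs// -(ler_int R) (le_trans (floor_le _))//.
    by rewrite -pmulrn natrX ler_piMl// exprn_ge0.
  rewrite /step_fun/= nth_mkseq// gez0_abs//.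
  have /andP[h1 h2] := floor_itv (n.+1%:R * c n (dyadic_index n t)).
  rewrite intrD in h2.
  have n0 : 0 < n.+1%:R :> R by rewrite ltr0n.
  rewrite -(ler_pM2l n0) divff ?gt_eqF// -[X in X * _]gtr0_norm// -normrM mulrBr.
  rewrite [n.+1%:R * (_ / _)]mulrC divfK ?gt_eqF// ler_norml; lra.
have sM n (t : R) : `[0%R, 1%R]%classic t -> `|step_fun (n, s n) t| <= M + 1.
  move=> /(near n) h; have := cM n (dyadic_index n t).
  have : n.+1%:R^-1 <= 1 :> R by rewrite invf_le1 ?ltr0n// ler1n.
  move: h; rewrite !ler_norml.
  move: (n.+1%:R^-1) (step_fun _ _) (c _ _) => r a b.
  by move=> /andP[? ?] ? /andP[? ?]; apply/andP; split; lra.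
have cv : {ae leb01 R, forall t, step_fun (n, s n) t @[n --> \oo] --> x t}.
  apply: ae01S2 (dyadic_differentiation ix) (ae_leb01_itv R) => t h t01.
  have {}h : c n (dyadic_index n t) @[n --> \oo] --> x t.
    by apply/fine_cvg.
  have k : c n (dyadic_index n t) - step_fun (n, s n) t @[n --> \oo] --> (0 : R).
    apply/norm_cvg0P.
    apply: (@squeeze_cvgr _ _ _ _ (cst 0) (fun n => n.+1%:R^-1)).
    - by apply: nearW => n; rewrite normr_ge0 near.
    - exact: cvg_cst.
    - exact: cvg_harmonic.
  rewrite -[x t]subr0 (_ : (fun n => step_fun _ _) = fun n =>
    c n (dyadic_index n t) - (c n (dyadic_index n t) - step_fun (n, s n) t)).
    exact: cvgB.
  by apply/funext => n; rewrite opprB addrC subrK.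
have [|||||_ _] := @dominated_convergence _ _ _ (leb01 R) setT measurableT
  (fun n t => ((x t - step_fun (n, s n) t) ^+ 2)%:E) (cst 0%E)
  (cst ((2 * M + 1) ^+ 2)%:E).
- move=> n; apply/measurable_EFinP/measurable_funX/measurable_funB => //.
  exact: measurable_step_fun.
- exact: measurable_cst.
- apply: ae01S cv => t h _ /=.
  apply: cvg_EFin; first exact: nearW.
  rewrite [X in _ --> X](_ : _ = (x t - x t) * (x t - x t)); last by rewrite subrr mul0r.
  by apply: cvgM; apply: cvgB => //; exact: cvg_cst.
- exact: leb01_integrable_cst.
- apply: ae01S (ae_leb01_itv R) => t t01 n _ /=.
  rewrite lee_fin ger0_norm ?sqr_ge0//.
  rewrite -[X in X <= _](real_normK (num_real _)) lerXn2r ?nnegrE//; first lra.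
  have := xM t; have := sM n t t01; rewrite !ler_norml; lra.
rewrite integral0 => h.
by have [n hn] := cvge_near_lt h (e:=e%:E) e0; exists (n, s n).
Qed.

(** Truncation of [x] where [|x|] exceeds [n] reduces to the bounded case; the truncation error is
    dominated by [x ^+ 2]. *)
Lemma step_dense (x : R -> R) (e : R) : measurable_fun setT x ->
  (\int[leb01 R]_t (x t ^+ 2)%:E < +oo)%E -> 0 < e ->
  exists p, (\int[leb01 R]_t ((x t - step_fun p t) ^+ 2)%:E < e%:E)%E.
Proof.
move=> mx xi e0.
have mD (n : nat) : measurable [set t | `|x t| <= n%:R].
  rewrite (_ : [set t | _] = ((fun a : R => `|a|) \o x) @^-1` `]-oo, n%:R]); last first.
    by apply/seteqP; split => t /=; rewrite in_itv.
  by rewrite -[X in measurable X]setTI; apply: measurableT_comp => //.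
pose xn (n : nat) := x \_ [set t | `|x t| <= n%:R].
have mxn n : measurable_fun setT (xn n).
  by apply/(measurable_restrictT _ (mD n)); exact: measurable_funTS.
have xnM n t : `|xn n t| <= n%:R.
  by rewrite /xn /patch; case: ifP; [rewrite inE|rewrite normr0].
have [|||||_ _] := @dominated_convergence _ _ _ (leb01 R) setT measurableT
  (fun n t => ((x t - xn n t) ^+ 2)%:E) (cst 0%E) (fun t => (x t ^+ 2)%:E).
- move=> n; apply/measurable_EFinP/measurable_funX/measurable_funB => //.
  exact: mxn.
- exact: measurable_cst.
- apply: aeW => t _ /=.
  apply: (@cvg_trans _ ((cst 0%E : (\bar R)^nat) @ \oo)); last exact: cvg_cst.
  apply: near_eq_cvg; near=> n => /=.
  rewrite /xn patchT ?subrr ?expr0n//= inE/=.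
  near: n; exact: nbhs_infty_ger.
- apply/integrableP; split; first by apply/measurable_EFinP/measurable_funX.
  by under eq_integral do rewrite gee0_abs ?lee_fin ?sqr_ge0//.
- apply: aeW => t n _ /=; rewrite lee_fin ger0_norm ?sqr_ge0// /xn /patch.
  by case: ifP => _; rewrite ?subr0// subrr expr0n sqr_ge0.
rewrite integral0 => h.
(* Two errors of [e / 4] add up to [e] through [(a - c)^2 <= 2 (a - b)^2 + 2 (b - c)^2]. *)
have e4 : 0 < e / 4 by rewrite divr_gt0.
have [n hn] := cvge_near_lt h (e:=(e/4)%:E) e4.
have [p hp] := step_dense_bounded (mxn n) (xnM n) e4.
exists p.
apply: (@le_lt_trans _ _ (2%:E * (\int[leb01 R]_t ((x t - xn n t) ^+ 2)%:E) +
   2%:E * (\int[leb01 R]_t ((xn n t - step_fun p t) ^+ 2)%:E))%E); last first.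
  rewrite (_ : e%:E = 2%:E * (e/4)%:E + 2%:E * (e/4)%:E)%E; last first.
    by rewrite -!EFinM -EFinD; congr EFin; field.
  by rewrite lteD// lte_pmul2l.
have mp := measurable_step_fun p.
have mxnn := mxn n.
rewrite -!ge0_integralZl//; last 4 first.
- by apply/measurable_EFinP/measurable_funX/measurable_funB.
- by move=> t _; rewrite lee_fin sqr_ge0.
- by apply/measurable_EFinP/measurable_funX/measurable_funB.
- by move=> t _; rewrite lee_fin sqr_ge0.
rewrite -ge0_integralD//; last 4 first.
- by move=> t _; rewrite -EFinM lee_fin mulr_ge0// sqr_ge0.
- by apply/measurable_EFinP/measurable_funM => //; exact/measurable_funX/measurable_funB.
- by move=> t _; rewrite -EFinM lee_fin mulr_ge0// sqr_ge0.
- by apply/measurable_EFinP/measurable_funM => //; exact/measurable_funX/measurable_funB.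
apply: ge0_le_integral => //.
- by move=> t _; rewrite lee_fin sqr_ge0.
- by apply/measurable_EFinP/measurable_funX/measurable_funB.
- apply/measurable_EFinP/measurable_funD; apply/measurable_funM => //;
    exact/measurable_funX/measurable_funB.
- move=> t _; rewrite -!EFinM -EFinD lee_fin.
  move: (x t) (xn n t) (step_fun p t) => a b c.
  (* This square is exactly the difference of the two sides. *)
  have := sqr_ge0 ((a - b) - (b - c)); rewrite !expr2; lra.
Unshelve. all: by end_near. Qed.

End step.

Section L2_metric.
Variable R : realType.
Implicit Types x y z : L2 R.

Lemma L2_dist_triangle x y z : (L2_dist x z <= L2_dist x y + L2_dist y z)%E.
Proof.
have mB (u v : L2 R) : measurable_fun setT (fun t => u t - v t).
  by apply: measurable_funB; exact: measurable_L2.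
have le12 : (1 <= 2%:E :> \bar R)%E by rewrite lee_fin ler1n.
apply: le_trans (eminkowski (leb01 R) (mB x y) (mB y z) le12).
rewrite le_eqVlt; apply/orP; left; apply/eqP/eq_Lnorm => t /=.
by rewrite addrA subrK.
Qed.

Lemma L2_distC x y : L2_dist x y = L2_dist y x.
Proof.
rewrite !L2_distE; congr (_ `^ _)%E; apply: eq_integral => t _.
by rewrite -sqrrN opprB.
Qed.

Lemma L2_dist_lt x y (r : R) : 0 < r ->
  (L2_dist x y < r%:E)%E = (\int[leb01 R]_t ((x t - y t) ^+ 2)%:E < (r ^+ 2)%:E)%E.
Proof.
move=> r0; rewrite L2_distE.
have : (0 <= \int[leb01 R]_t ((x t - y t) ^+ 2)%:E)%E.
  by apply: integral_ge0 => t _; rewrite lee_fin sqr_ge0.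
case: (\int[_]_t _)%E => [a| |] //; last by rewrite poweRyr ?invr_neq0.
rewrite lee_fin => a0; rewrite poweR_EFin powR12_sqrt// !lte_fin.
by rewrite -(ltr_pXn2r (n:=2))// ?nnegrE ?sqrtr_ge0 ?ltW// sqr_sqrtr.
Qed.

Lemma measurable_L2_ball x (r : R) : measurable [set y | (L2_dist x y < r%:E)%E].
Proof.
apply: sub_sigma_algebra => y /= xy.
have xyfin : L2_dist x y \is a fin_num.
  by rewrite ge0_fin_numE ?Lnorm_ge0// (lt_trans xy) ?ltry.
exists (r - fine (L2_dist x y)).
  by rewrite subr_gt0 -lte_fin fineK.
move=> z; rewrite EFinB fineK// lteBrDl// => h.
exact: le_lt_trans (L2_dist_triangle x y z) h.
Qed.

Definition step_seq (j : nat) : R -> R := oapp (@step_fun R) (cst 0) (unpickle j).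

Lemma measurable_step_seq j : measurable_fun setT (step_seq j).
Proof.
rewrite /step_seq; case: (unpickle j) => [p|] /=; last exact: measurable_cst.
exact: measurable_step_fun.
Qed.

Lemma step_seq_sq_lty j : (\int[leb01 R]_t (step_seq j t ^+ 2)%:E < +oo)%E.
Proof.
rewrite /step_seq; case: (unpickle j) => [p|] /=; first exact: step_fun_sq_lty.
by under eq_integral do rewrite expr0n/=; rewrite integral0 ltry.
Qed.

Definition step_L2 (j : nat) : L2 R :=
  sval (cid (L2_ex (measurable_step_seq j) (step_seq_sq_lty j))).

Lemma step_L2E j : {ae leb01 R, forall t, step_L2 j t = step_seq j t}.
Proof. exact: (svalP (cid (L2_ex (measurable_step_seq j) (step_seq_sq_lty j)))). Qed.

Lemma step_L2_dist x j : (\int[leb01 R]_t ((x t - step_L2 j t) ^+ 2)%:E =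
  \int[leb01 R]_t ((x t - step_seq j t) ^+ 2)%:E)%E.
Proof.
apply: ae01_eq_integral.
- by apply/measurable_EFinP/measurable_funX/measurable_funB; exact: measurable_L2.
- apply/measurable_EFinP/measurable_funX/measurable_funB.
    exact: measurable_L2.
  exact: measurable_step_seq.
- by apply: ae01S (step_L2E j) => t ->.
Qed.

Lemma step_L2_dense x (r : R) : 0 < r -> exists j, (L2_dist x (step_L2 j) < r%:E)%E.
Proof.
move=> r0; have r20 : 0 < r ^+ 2 by rewrite exprn_gt0.
have [p hp] := step_dense (measurable_L2 x) (finite_L2 x) r20.
by exists (pickle p); rewrite L2_dist_lt// step_L2_dist /step_seq pickleK.
Qed.

Lemma step_L2_dense_pow (n : nat) x : exists j, (L2_dist x (step_L2 j) < (2^-1 ^+ n)%:E)%E.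
Proof. by apply: step_L2_dense; rewrite exprn_gt0// invr_gt0. Qed.

(** Taking the least index makes the choice measurable: the fibre over [j] is a ball around
    [step_L2 j] minus finitely many earlier balls. *)
Definition approx_idx (n : nat) x : nat := ex_minn (step_L2_dense_pow n x).

Lemma approx_idxP n x : (L2_dist x (step_L2 (approx_idx n x)) < (2^-1 ^+ n)%:E)%E.
Proof. by rewrite /approx_idx; case: ex_minnP. Qed.

Lemma measurable_approx_idx n : measurable_fun setT (approx_idx n).
Proof.
apply: measurable_fun_nat => j.
pose B i := [set x | (L2_dist (step_L2 i) x < (2^-1 ^+ n)%:E)%E].
have mB i : measurable (B i) by exact: measurable_L2_ball.
rewrite (_ : _ @^-1` _ = B j `&` \bigcap_(i in [set i | (i < j)%N]) ~` B i).
  apply: measurableI => //; apply: bigcap_measurableType => i _.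
  exact: measurableC.
apply/seteqP; split=> x; rewrite /B /approx_idx/=.
  move=> <-; case: ex_minnP => k hk km; split=> [|i /= ik].
    by rewrite L2_distC.
  by rewrite L2_distC => /km; rewrite leqNgt ik.
move=> [h1 h2]; case: ex_minnP => k hk km.
apply/eqP; rewrite eqn_leq km ?[L2_dist x _]L2_distC//= leqNgt.
by apply/negP => kj; apply: (h2 k) => //=; rewrite L2_distC.
Qed.

Definition approx (n : nat) x (t : R) : R := step_seq (approx_idx n x) t.

(** [approx n] depends on [x] only through an integer, so a preimage is a countable union of
    measurable rectangles. *)
Lemma measurable_approx n : measurable_fun setT
  (fun xt : L2 R * measurableTypeR R => approx n xt.1 xt.2 : measurableTypeR R).
Proof.
move=> _ B mB; rewrite setTI.
rewrite (_ : _ @^-1` _ = \bigcup_j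
  ((approx_idx n @^-1` [set j]) `*` (step_seq j @^-1` B))).
  apply: bigcupT_measurable => j; apply: measurableX.
    by rewrite -[X in measurable X]setTI; exact: measurable_approx_idx.
  by rewrite -[X in measurable X]setTI; exact: measurable_step_seq.
apply/seteqP; split=> -[x t] /=; rewrite /approx/=.
  by move=> h; exists (approx_idx n x).
by move=> [j _ [/= -> //]].
Qed.

(* The squared errors have summable integrals. *)
Lemma approx_cvg x : {ae leb01 R, forall t, approx n x t @[n --> \oo] --> x t}.
Proof.
pose f n t := ((x t - approx n x t) ^+ 2)%:E.
have f0 n t : (0 <= f n t)%E by rewrite lee_fin sqr_ge0.
have mf n : measurable_fun setT (f n).
  apply/measurable_EFinP/measurable_funX/measurable_funB.
    exact: measurable_L2.
  exact: measurable_step_seq.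
have h2 : {ae leb01 R, forall t, (\sum_(n <oo) f n t < +oo)%E}.
  apply: ae_lty.
  - by apply: ge0_emeasurable_sum => [k t _ _|k _]; [exact: f0|exact: mf].
  - by move=> t; exact: nneseries_ge0.
  rewrite integral_nneseries//.
  apply: (@le_lt_trans _ _ (\sum_(n <oo) (2^-1 ^+ n)%:E)%E).
    apply: lee_nneseries => [n _ _|n _].
      by apply: integral_ge0 => t _; exact: f0.
    rewrite -step_L2_dist; apply: ltW.
    have := approx_idxP n x; rewrite L2_dist_lt ?exprn_gt0 ?invr_gt0//.
    move=> /lt_le_trans; apply; rewrite lee_fin -exprM.
    by apply: ler_wiXn2l; rewrite ?invr_ge0 ?invf_le1 ?ler1n// leq_pmulr.
  have := @cvg_geometric_series R 1 2^-1.
  rewrite ger0_norm ?invr_ge0// invf_lt1// ltr1n => /(_ isT) h.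
  rewrite (_ : (\sum_(n <oo) _)%E = (1 / (1 - 2^-1))%:E) ?ltry//.
  apply/cvg_lim => //.
  rewrite (_ : (fun n => _) = EFin \o series (geometric 1 2^-1)).
    by apply: cvg_EFin => //; exact: nearW.
  apply/funext => n /=; rewrite /series/= sumEFin; congr EFin.
  by apply: eq_bigr => i _; rewrite mul1r.
apply: ae01S h2 => t ht.
have := nneseries_cvg0 (fun n => f0 n t) ht.
move=> /fine_cvgP[_ /=]; rewrite /f/= => h.
have k : x t - approx n x t @[n --> \oo] --> (0 : R).
  apply/norm_cvg0P.
  rewrite (_ : (fun n => _) = fun n => Num.sqrt ((x t - approx n x t) ^+ 2)); last first.
    by apply/funext => n; rewrite sqrtr_sqr.
  rewrite -[X in _ --> X](@sqrtr0 R).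
  apply: (@continuous_cvg _ _ _ _ _
    (fun n => (x t - approx n x t) ^+ 2) (@Num.sqrt R) 0) => //.
  exact: sqrt_continuous.
rewrite -[x t]subr0 (_ : (fun n => approx _ _ _) = fun n => x t - (x t - approx n x t)).
  by apply: cvgB => //; exact: cvg_cst.
by apply/funext => n; rewrite opprB addrC subrK.
Qed.

(** A limit superior is measurable in [(x, t)] with no convergence to establish; for each [x] it is
    the limit for almost every [t], and its value elsewhere is irrelevant. *)
Definition L2_eval (xt : L2 R * measurableTypeR R) : measurableTypeR R :=
  fine (limn_esup (fun n => (approx n xt.1 xt.2)%:E)).

Lemma measurable_L2_eval : measurable_fun setT L2_eval.
Proof.
apply: measurableT_comp; first exact: fine_measurable.
apply: measurable_fun_limn_esup => n; apply/measurable_EFinP.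
exact: measurable_approx.
Qed.

Lemma L2_evalE x : {ae leb01 R, forall t, L2_eval (x, t) = x t}.
Proof.
apply: ae01S (approx_cvg x) => t h; rewrite /L2_eval/=.
have h' : (approx n x t)%:E @[n --> \oo] --> (x t)%:E by apply: cvg_EFin => //; exact: nearW.
by rewrite is_cvg_limn_esupE ?(cvg_lim _ h')//; apply/cvg_ex; exists (x t)%:E.
Qed.

(** By density, an open set is the union of the balls with centre [step_L2 j] and radius [1/(k+1)]
    that it contains. The preimage of such a ball is a sublevel set of the integral of
    [(phi (w, t) - step_seq j t)^2] in [t], which is measurable in [w] by Tonelli. *)
Lemma measurable_fun_L2 (d : measure_display) (T : measurableType d)
    (phi : T * measurableTypeR R -> measurableTypeR R) (F : T -> L2 R) :
  measurable_fun setT phi ->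
  (forall w, {ae leb01 R, forall t, F w t = phi (w, t)}) ->
  measurable_fun setT F.
Proof.
move=> mphi Fphi.
apply: (@measurability _ _ _ _ _ _ (@L2_open R)) => //.
move=> _ [U oU <-]; rewrite setTI.
pose r k : R := k.+1%:R^-1.
have r0 k : 0 < r k by rewrite invr_gt0 ltr0n.
pose B j k := [set y | (L2_dist (step_L2 j) y < (r k)%:E)%E].
rewrite (_ : F @^-1` U = \bigcup_j \bigcup_(k in [set k | B j k `<=` U]) (F @^-1` (B j k))).
  apply: bigcupT_measurable => j; apply: bigcup_measurable => k _.
  rewrite (_ : _ @^-1` _ = (fun w => \int[leb01 R]_t ((phi (w, t) - step_seq j t) ^+ 2)%:E)%E
    @^-1` `]-oo, ((r k) ^+ 2)%:E[%classic); last first.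
    apply/seteqP; split => w; rewrite /B/= in_itv/= L2_distC L2_dist_lt// step_L2_dist;
      rewrite (@ae01_eq_integral _ _ (fun t => ((phi (w, t) - step_seq j t) ^+ 2)%:E))//.
    1,4: apply/measurable_EFinP/measurable_funX/measurable_funB;
         [exact: measurable_L2|exact: measurable_step_seq].
    1,3: apply/measurable_EFinP/measurable_funX/measurable_funB;
         [exact: measurableT_comp|exact: measurable_step_seq].
    1,2: by apply: ae01S (Fphi w) => t ->.
  rewrite -[X in measurable X]setTI.
  apply: (@measurable_integral01 R _ T (fun wt => ((phi wt - step_seq j wt.2) ^+ 2)%:E)) => //.
  - apply/measurable_EFinP/measurable_funX/measurable_funB => //.
    by apply: measurableT_comp => //; exact: measurable_step_seq.
  - by move=> wt; rewrite lee_fin sqr_ge0.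
  - exact: emeasurable_itv.
apply/seteqP; split=> w /=; last by move=> [j _ [k /= + h]]; exact.
move=> Uw; have [e e0 eU] := oU _ Uw.
(* Both [F w] and an arbitrary point of the ball are within [r k] of its centre, hence within [e] of
   each other. *)
have [k hk] : exists k, r k < e / 2.
  have := near_infty_natSinv_lt (PosNum (divr_gt0 e0 (ltr0Sn R 1))).
  by move=> [N _ /(_ N (leqnn N))]; exists N.
have [j hj] := step_L2_dense (F w) (r0 k).
exists j => //; exists k => /=; last by rewrite /B/= L2_distC.
move=> y /= hy; apply: eU.
apply: le_lt_trans (L2_dist_triangle _ (step_L2 j) _) _.
apply: lt_trans (lteD hj hy) _; rewrite -EFinD lte_fin; lra.
Qed.

End L2_metric.

(** * Cauchy-Schwarz and Minkowski in [0, +oo] *)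

Section cauchy_schwarz.
Local Open Scope ereal_scope.
Context (d : measure_display) (T : measurableType d) (R : realType).
Variable mu : {measure set T -> \bar R}.
Implicit Types u w : T -> \bar R.

(** For finite values this is [c^-1 (c x - y)^2 >= 0]; otherwise the right side is infinite. The
    free factor [c] is optimised after integration. *)
Lemma young_ereal (c : R) (x y : \bar R) : (0 < c)%R -> 0 <= x -> 0 <= y ->
  2%:E * (x * y) <= c%:E * (x * x) + c^-1%:E * (y * y).
Proof.
move=> c0; have ci0 : (0 < c^-1)%R by rewrite invr_gt0.
case: x => [x| |]//; case: y => [y| |]// x0 y0.
- rewrite -!EFinM -EFinD lee_fin.
  have := sqr_ge0 (c * x - y)%R; rewrite -(pmulr_rge0 _ ci0) => h.
  have -> : (2 * (x * y) = 2 * (c^-1 * c) * (x * y))%R.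
    by rewrite mulVf ?gt_eqF// mulr1.
  have -> : (c * (x * x) = (c^-1 * c) * (c * (x * x)))%R.
    by rewrite mulVf ?gt_eqF// mul1r.
  rewrite -subr_ge0; apply: le_trans h _; rewrite le_eqVlt; apply/orP; left.
  by apply/eqP; ring.
- have -> : c^-1%:E * (+oo * +oo) = +oo by rewrite mulyy gt0_muley ?lte_fin.
  by rewrite addey ?leey// -EFinM.
- have -> : c%:E * (+oo * +oo) = +oo by rewrite mulyy gt0_muley ?lte_fin.
  by rewrite addye ?leey// -EFinM.
- have -> : c%:E * (+oo * +oo) = +oo by rewrite mulyy gt0_muley ?lte_fin.
  have -> : c^-1%:E * (+oo * +oo) = +oo by rewrite mulyy gt0_muley ?lte_fin.
  by rewrite leey.
Qed.

(** The case in which the optimal factor degenerates: [u] vanishes almost everywhere, and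
    [0 * +oo = 0] lets [w] be infinite. *)
Lemma ge0_sq_integral_eq0 u w : measurable_fun setT u -> measurable_fun setT w ->
  (forall x, 0 <= u x) -> (forall x, 0 <= w x) ->
  \int[mu]_x (u x * u x) = 0 -> \int[mu]_x (u x * w x) = 0.
Proof.
move=> mu' mw u0 w0 h.
have m2 : measurable_fun setT (fun x => u x * u x) by exact: emeasurable_funM.
have h' : \int[mu]_x `|u x * u x| = 0.
  by under eq_integral do rewrite gee0_abs ?mule_ge0//.
have /(ae_eq_integral_abs _ measurableT m2) k := h'.
rewrite (ae_eq_integral (cst 0)) ?integral0//.
  exact: emeasurable_funM.
apply: filterS k => x /(_ I) /= /eqP; rewrite mule_eq0 orbb => /eqP -> _.
by rewrite mul0e.
Qed.

(** Written with squares in [0, +oo], so that it applies before the iterates are known to be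
    finite. *)
Lemma ge0_cauchy_schwarz u w : measurable_fun setT u -> measurable_fun setT w ->
  (forall x, 0 <= u x) -> (forall x, 0 <= w x) ->
  (\int[mu]_x (u x * w x)) * (\int[mu]_x (u x * w x)) <=
  (\int[mu]_x (u x * u x)) * (\int[mu]_x (w x * w x)).
Proof.
move=> mu' mw u0 w0.
have muw : measurable_fun setT (fun x => u x * w x) by exact: emeasurable_funM.
have muu : measurable_fun setT (fun x => u x * u x) by exact: emeasurable_funM.
have mww : measurable_fun setT (fun x => w x * w x) by exact: emeasurable_funM.
have uu0 : 0 <= \int[mu]_x (u x * u x) by apply: integral_ge0 => x _; exact: mule_ge0.
have ww0 : 0 <= \int[mu]_x (w x * w x) by apply: integral_ge0 => x _; exact: mule_ge0.
have uw0 : 0 <= \int[mu]_x (u x * w x) by apply: integral_ge0 => x _; exact: mule_ge0.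
have [u2|u2] := eqVneq (\int[mu]_x (u x * u x)) 0.
  by rewrite u2 mul0e (ge0_sq_integral_eq0 mu' mw u0 w0 u2) mul0e.
have [w2|w2] := eqVneq (\int[mu]_x (w x * w x)) 0.
  rewrite w2 mule0; under eq_integral do rewrite muleC.
  by rewrite (ge0_sq_integral_eq0 mw mu' w0 u0 w2) mul0e.
have key (c : R) : (0 < c)%R -> 2%:E * (\int[mu]_x (u x * w x)) <=
    c%:E * (\int[mu]_x (u x * u x)) + c^-1%:E * (\int[mu]_x (w x * w x)).
  move=> c0; have ci0 : (0 < c^-1)%R by rewrite invr_gt0.
  rewrite -!ge0_integralZl// ?lee_fin ?(ltW c0) ?(ltW ci0)//; try by move=> x _; exact: mule_ge0.
  rewrite -ge0_integralD//; first last.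
  - exact: measurable_funeM.
  - by move=> x _; rewrite !mule_ge0// lee_fin ltW.
  - exact: measurable_funeM.
  - by move=> x _; rewrite !mule_ge0// lee_fin ltW.
  apply: ge0_le_integral => //.
  - by move=> x _; rewrite !mule_ge0.
  - exact: measurable_funeM.
  - by apply: emeasurable_funD; exact: measurable_funeM.
  - by move=> x _; exact: young_ereal.
move: uu0 ww0 uw0 u2 w2 key.
case: (\int[mu]_x (u x * u x)) => [a| |]//; case: (\int[mu]_x (w x * w x)) => [b| |]//;
  rewrite ?lee_fin ?eqe => a0 b0 + an bn.
- have {an}a0 : (0 < a)%R by rewrite lt_neqAle eq_sym an.
  have {bn}b0 : (0 < b)%R by rewrite lt_neqAle eq_sym bn.
  move=> i0 key.
  (* The minimiser of [c a + b / c], whose minimum is [2 sqrt (a b)]. *)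
  have c0 : (0 < Num.sqrt b / Num.sqrt a)%R by rewrite divr_gt0 ?sqrtr_gt0.
  move: (key _ c0); move: i0; case: (\int[mu]_x (u x * w x)) => [i| |]//; last first.
    by rewrite [2%:E * +oo]gt0_muley ?lte_fin// -!EFinM -EFinD leye_eq.
  rewrite -!EFinM -EFinD !lee_fin => i0.
  rewrite invf_div; set sa := Num.sqrt a; set sb := Num.sqrt b.
  have sa0 : (0 < sa)%R by rewrite sqrtr_gt0.
  have sb0 : (0 < sb)%R by rewrite sqrtr_gt0.
  have -> : a = (sa ^+ 2)%R by rewrite sqr_sqrtr ?ltW.
  have -> : b = (sb ^+ 2)%R by rewrite sqr_sqrtr ?ltW.
  have -> : (sb / sa * sa ^+ 2 + sa / sb * sb ^+ 2 = 2 * (sa * sb))%R.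
    by field; rewrite !gt_eqF.
  rewrite ler_pM2l// => h.
  rewrite -exprMn -expr2 lerXn2r ?nnegrE//.
  exact: le_trans h.
- by move=> _ _; rewrite gt0_muley ?leey// lte_fin lt_neqAle eq_sym an.
- by move=> _ _; rewrite gt0_mulye ?leey// lte_fin lt_neqAle eq_sym bn.
- by move=> _ _; rewrite mulyy leey.
Qed.

(** Expand the square and bound the cross term by Cauchy-Schwarz. Real bounds [A], [B] on the norms
    keep the recursion for the iterates free of square roots. *)
Lemma ge0_minkowski2 u w (A B : R) : measurable_fun setT u -> measurable_fun setT w ->
  (forall x, 0 <= u x) -> (forall x, 0 <= w x) -> (0 <= A)%R -> (0 <= B)%R ->
  \int[mu]_x (u x * u x) <= (A ^+ 2)%:E -> \int[mu]_x (w x * w x) <= (B ^+ 2)%:E ->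
  \int[mu]_x ((u x + w x) * (u x + w x)) <= ((A + B) ^+ 2)%:E.
Proof.
move=> mu' mw u0 w0 A0 B0 hA hB.
have muw : measurable_fun setT (fun x => u x * w x) by exact: emeasurable_funM.
have muu : measurable_fun setT (fun x => u x * u x) by exact: emeasurable_funM.
have mww : measurable_fun setT (fun x => w x * w x) by exact: emeasurable_funM.
have uw0 : 0 <= \int[mu]_x (u x * w x) by apply: integral_ge0 => x _; exact: mule_ge0.
have hAB : \int[mu]_x (u x * w x) <= (A * B)%:E.
  have : (\int[mu]_x (u x * w x)) * (\int[mu]_x (u x * w x)) <= ((A * B) ^+ 2)%:E.
    apply: le_trans (ge0_cauchy_schwarz mu' mw u0 w0) _.
    rewrite exprMn EFinM; apply: lee_pmul => //;
      by apply: integral_ge0 => x _; exact: mule_ge0.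
  move: uw0; case: (\int[mu]_x (u x * w x)) => [i| |]//.
  rewrite -EFinM !lee_fin -expr2 => i0.
  by rewrite ler_pXn2r ?nnegrE ?mulr_ge0.
have -> : \int[mu]_x ((u x + w x) * (u x + w x)) =
    \int[mu]_x (u x * u x + (2%:E * (u x * w x) + w x * w x)).
  apply: eq_integral => x _.
  rewrite ge0_muleDl// !ge0_muleDr// -addeA; congr (_ + _); rewrite addeA; congr (_ + _).
  rewrite (muleC (w x)) -(mul1e (u x * w x)) -ge0_muleDl ?lee_fin// -EFinD mul1e.
  by rewrite -[(1 + 1)%R]/(2%R).
rewrite ge0_integralD//; last 3 first.
- by move=> x _; exact: mule_ge0.
- by move=> x _; rewrite adde_ge0// !mule_ge0.
- by apply: emeasurable_funD => //; exact: measurable_funeM.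
rewrite ge0_integralD//; last 3 first.
- by move=> x _; rewrite !mule_ge0.
- exact: measurable_funeM.
- by move=> x _; rewrite !mule_ge0.
rewrite ge0_integralZl//; last by move=> x _; rewrite !mule_ge0.
have -> : (((A + B) ^+ 2)%:E = (A ^+ 2)%:E + (2%:E * (A * B)%:E + (B ^+ 2)%:E)).
  by rewrite -EFinM -!EFinD; congr EFin; ring.
by apply: leeD => //; apply: leeD => //; rewrite lee_pmul2l.
Qed.

End cauchy_schwarz.

(** * The kernel operator *)

Section kernel.
Variables (R : realType) (b : R -> R -> R).
Hypothesis mb : measurable_fun setT (fun ts : measurableTypeR R * measurableTypeR R =>
                         b ts.1 ts.2 : measurableTypeR R).

Lemma measurable_kernel_section t : measurable_fun setT (b t).
Proof.
apply: (measurableT_comp (f := fun ts : measurableTypeR R * measurableTypeR R =>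
   b ts.1 ts.2) mb (g := fun s => (t, s))).
by apply: measurable_fun_pair => //; exact: measurable_cst.
Qed.

(** The kernel is non-negative only almost everywhere; its positive part makes every integrand
    non-negative at every point. [kernel_ae_pos_kernel] shows that this changes nothing. *)
Definition pos_kernel (t s : R) : R := Num.max (b t s) 0.

Lemma pos_kernel_ge0 t s : 0 <= pos_kernel t s.
Proof. by rewrite /pos_kernel le_max lexx orbT. Qed.

Lemma measurable_pos_kernel : measurable_fun setT (fun ts : measurableTypeR R * measurableTypeR R =>
                         pos_kernel ts.1 ts.2 : measurableTypeR R).
Proof. by apply: measurable_maxr => //; exact: measurable_cst. Qed.

(* beta (e^2 u), computed with the positive part of the kernel. *)
Definition arch_op (e : R -> R) (u : R -> \bar R) (t : R) : \bar R :=
  (\int[leb01 R]_s ((pos_kernel t s * e s ^+ 2)%:E * u s))%E.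

Lemma arch_op_ge0 e u t : (forall s, 0 <= u s)%E -> (0 <= arch_op e u t)%E.
Proof.
move=> u0; apply: integral_ge0 => s _; apply: mule_ge0 => //.
by rewrite lee_fin mulr_ge0 ?pos_kernel_ge0 ?sqr_ge0.
Qed.

Lemma measurable_arch_op_par (d : measure_display) (T : measurableType d)
    (e : T * measurableTypeR R -> R) (u : T * measurableTypeR R -> \bar R) :
  measurable_fun setT e -> measurable_fun setT u -> (forall x, 0 <= u x)%E ->
  measurable_fun setT (fun xt : T * measurableTypeR R =>
    arch_op (fun s => e (xt.1, s)) (fun s => u (xt.1, s)) xt.2).
Proof.
move=> me mu u0.
apply: (@measurable_integral01 R _ _
  (fun xts : (T * measurableTypeR R) * measurableTypeR R =>
   ((pos_kernel xts.1.2 xts.2 * e (xts.1.1, xts.2) ^+ 2)%:E * u (xts.1.1, xts.2))%E)).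
  have m1 : measurable_fun setT
      (fun xts : (T * measurableTypeR R) * measurableTypeR R => (xts.1.1, xts.2)).
    apply: measurable_fun_pair => //.
    exact: measurableT_comp.
  apply: emeasurable_funM; last exact: measurableT_comp.
  apply/measurable_EFinP/measurable_funM; last first.
    by apply: measurable_funX; exact: measurableT_comp.
  apply: (measurableT_comp measurable_pos_kernel (g := fun xts => (xts.1.2, xts.2))).
  by apply: measurable_fun_pair => //; exact: measurableT_comp.
move=> x; apply: mule_ge0 => //.
by rewrite lee_fin mulr_ge0 ?pos_kernel_ge0 ?sqr_ge0.
Qed.

Lemma measurable_arch_op (e : R -> R) (u : R -> \bar R) :
  measurable_fun setT e -> measurable_fun setT u -> (forall x, 0 <= u x)%E ->
  measurable_fun setT (arch_op e u).
Proof.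
move=> me mu u0.
have h : measurable_fun setT (fun xt : measurableTypeR R * measurableTypeR R =>
    arch_op (fun s => (e \o snd) (xt.1, s)) (fun s => (u \o snd) (xt.1, s)) xt.2).
  apply: measurable_arch_op_par; last by move=> x; exact: u0.
    exact: measurableT_comp.
  exact: measurableT_comp.
have m0 : measurable_fun setT (fun t : measurableTypeR R => (0 : measurableTypeR R, t)).
  by apply: measurable_fun_pair => //; exact: measurable_cst.
exact: (measurableT_comp h m0).
Qed.

(** The Hilbert-Schmidt bound for the kernel [b t s * e s ^+ 2], whose square is the integrand of
    [K]: Cauchy-Schwarz in [s] for fixed [t], then integration in [t]. *)
Lemma arch_op_bound (e : R -> R) (u : R -> \bar R) :
  measurable_fun setT e -> measurable_fun setT u -> (forall x, 0 <= u x)%E ->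
  (\int[leb01 R]_t (arch_op e u t * arch_op e u t) <=
   (\int[leb01 R]_t \int[leb01 R]_s (b t s ^+ 2 * e s ^+ 4)%:E) *
   (\int[leb01 R]_s (u s * u s)))%E.
Proof.
move=> me mu u0.
have mop := measurable_arch_op me mu u0.
have mpk t : measurable_fun setT (pos_kernel t).
  by apply: measurable_maxr; [exact: measurable_kernel_section|exact: measurable_cst].
have mK : measurable_fun setT (fun t => \int[leb01 R]_s (b t s ^+ 2 * e s ^+ 4)%:E)%E.
  apply: (@measurable_integral01 R _ (measurableTypeR R) (fun ts => (b ts.1 ts.2 ^+ 2 * e ts.2 ^+ 4)%:E)).
    apply/measurable_EFinP/measurable_funM; first exact: measurable_funX.
    by apply: measurable_funX; exact: measurableT_comp.
  by move=> x; rewrite lee_fin mulr_ge0 ?sqr_ge0// (exprM _ 2 2) sqr_ge0.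
rewrite -ge0_integralZr//; last 2 first.
- move=> t _; apply: integral_ge0 => s _.
  by rewrite lee_fin mulr_ge0 ?sqr_ge0// (exprM _ 2 2) sqr_ge0.
- by apply: integral_ge0 => s _; exact: mule_ge0.
apply: ge0_le_integral => //.
- by move=> t _; apply: mule_ge0; exact: arch_op_ge0.
- exact: emeasurable_funM.
- by apply: emeasurable_funM => //; exact: measurable_cst.
move=> t _.
have mk : measurable_fun setT (fun s => (pos_kernel t s * e s ^+ 2)%:E).
  by apply/measurable_EFinP/measurable_funM => //; exact: measurable_funX.
have k0 s : (0 <= (pos_kernel t s * e s ^+ 2)%:E)%E.
  by rewrite lee_fin mulr_ge0 ?pos_kernel_ge0 ?sqr_ge0.
rewrite /arch_op; apply: le_trans (ge0_cauchy_schwarz (leb01 R) mk mu k0 u0) _.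
apply: lee_wpmul2r; first by apply: integral_ge0 => s _; exact: mule_ge0.
apply: ge0_le_integral => //.
- by move=> s _; apply: mule_ge0.
- exact: emeasurable_funM.
- apply/measurable_EFinP/measurable_funM.
    by apply: measurable_funX; exact: measurable_kernel_section.
  exact: measurable_funX.
move=> s _; rewrite -EFinM lee_fin.
rewrite mulrACA -expr2 -expr2 -exprM ler_wpM2r ?(exprM _ 2 2) ?sqr_ge0//.
by rewrite /pos_kernel; case: (leP (b t s) 0) => // _; rewrite expr0n sqr_ge0.
Qed.

Hypothesis b_ge0 : nonneg_kernel_op b.
Hypothesis b_bounded : bounded_kernel_op b.

(** Boundedness of the operator, tested on the constant function 1. *)
Lemma kernel_ae_integrable :
  {ae leb01 R, forall t, (leb01 R).-integrable setT (EFin \o b t)}.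
Proof.
have [|x1 x1E] := @L2_ex R (cst 1) (measurable_cst _).
  by rewrite (_ : (fun t => _) = cst 1%E) ?integral_cst// ?leb01_setT ?mule1 ?ltry//
    ; apply/funext => t /=; rewrite expr1n.
have [_ [M /(_ x1)[h _]]] := b_bounded.
apply: ae01S h => t /integrableP[_ ti]; apply/integrableP; split.
  by apply/measurable_EFinP; exact: measurable_kernel_section.
move: ti; rewrite (@ae01_eq_integral _ _ (fun s => `|(EFin \o b t) s|)%E)//.
- apply: measurableT_comp => //; apply/measurable_EFinP/measurable_funM.
    exact: measurable_kernel_section.
  exact: measurable_L2.
- by apply: measurableT_comp => //; apply/measurable_EFinP; exact: measurable_kernel_section.
- by apply: ae01S x1E => s -> /=; rewrite mulr1.
Qed.

Lemma kernel_ae_cell_ge0 n m : {ae leb01 R, forall t,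
  (0 <= \int[leb01 R]_(s in dyadic_cell n m) (b t s)%:E)%E}.
Proof.
have mc := @measurable_dyadic_cell R n m.
have mi : measurable_fun setT (\1_(dyadic_cell n m) : R -> R) by exact: measurable_indic.
have [|x xE] := L2_ex mi.
  apply: (@le_lt_trans _ _ (\int[leb01 R]_t (cst 1%E t))%E).
    apply: ge0_le_integral => //.
    - exact/measurable_EFinP/measurable_funX.
    - by move=> t _; rewrite lee_fin indicE expr_le1//; case: (_ \in _).
  by rewrite integral_cst// leb01_setT mule1 ltry.
have x0 : L2_nonneg x by apply: ae01S xE => t ->; rewrite indicE.
apply: ae01S (b_ge0 x0) => t; rewrite /kernel_op.
rewrite (@ae01_eq_integral _ _ (fun s => (b t s * \1_(dyadic_cell n m) s)%:E))//.
- rewrite [X in _ -> (0 <= X)%E]integral_mkcond.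
  rewrite (_ : _ \_ _ = fun s => (b t s * \1_(dyadic_cell n m) s)%:E)//.
  by apply/funext => s; rewrite /patch indicE; case: ifP; rewrite ?mulr1 ?mulr0.
- apply/measurable_EFinP/measurable_funM; first exact: measurable_kernel_section.
  exact: measurable_L2.
- by apply/measurable_EFinP/measurable_funM => //; exact: measurable_kernel_section.
- by apply: ae01S xE => s ->.
Qed.

(** Non-negativity of the operator gives, for each test function, a null set of [t] that depends on
    it. With the indicators of the countably many dyadic cells as tests these sets have a null
    union, and off it differentiation in [s] yields the sign of [b t s]. *)
Lemma kernel_ae_pos_kernel : {ae leb01 R, forall t, {ae leb01 R, forall s, b t s = pos_kernel t s}}.
Proof.
have h : {ae leb01 R, forall t, forall n k,
    (0 <= \int[leb01 R]_(s in dyadic_cell n k%:Z) (b t s)%:E)%E /\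
    (0 <= \int[leb01 R]_(s in dyadic_cell n (- k%:Z)) (b t s)%:E)%E}.
  apply: ae_foralln => n; apply: ae_foralln => k.
  by apply: ae01S2 (kernel_ae_cell_ge0 n k%:Z) (kernel_ae_cell_ge0 n (- k%:Z)) => t; split.
apply: ae01S2 kernel_ae_integrable h => t ti th.
apply: (@ae01S _ (fun s => 0 <= b t s)) => [s bs|].
  by rewrite /pos_kernel max_l.
apply: ae_ge0_dyadic => //.
move=> n [k|k]; first by have [] := th n k.
by have [] := th n k.+1; rewrite NegzE.
Qed.

(** The passage from the integral of the equations to the one in [0, +oo]. It serves with [e] the
    noise and [v = sigma^2], and also with [e = 1] and [v = y^2]. *)
Lemma kernel_op_arch_op (e v : R -> R) (u : R -> \bar R) (z : R -> R) :
  measurable_fun setT e -> measurable_fun setT v -> measurable_fun setT u ->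
  measurable_fun setT z ->
  {ae leb01 R, forall s, z s = e s ^+ 2 * v s} ->
  {ae leb01 R, forall s, (v s)%:E = u s} ->
  {ae leb01 R, forall t, kernel_op b z t = arch_op e u t}.
Proof.
move=> me mv mu mz zE vu.
apply: ae01S kernel_ae_pos_kernel => t ht; apply: ae01_eq_integral.
- apply/measurable_EFinP/measurable_funM => //; exact: measurable_kernel_section.
- apply: emeasurable_funM => //; apply/measurable_EFinP/measurable_funM.
    by apply: measurable_maxr; [exact: measurable_kernel_section|exact: measurable_cst].
  exact: measurable_funX.
- apply: ae01S3 ht zE vu => s -> -> <-.
  by rewrite -EFinM mulrA.
Qed.

End kernel.

(** * Independent identically distributed sequences *)

Section cylinder.
Context (d d' : measure_display) (T : measurableType d) (X : measurableType d').

Lemma measurable_cylinder_map (I : Type) (e : I -> T -> X) :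
  (forall i, measurable_fun setT (e i)) ->
  forall C, <<s @cylinders I d' X >> C -> measurable [set w | C (fun i => e i w)].
Proof.
move=> me.
pose F (w : T) : g_sigma_algebraType (@cylinders I d' X) := fun i => e i w.
have mF : measurable_fun setT F.
  apply: (@measurability _ _ T (g_sigma_algebraType (@cylinders I d' X)) setT F
    (@cylinders I d' X)) => //.
  move=> _ [_ [i [A [mA ->]]] <-].
  exact: (me i measurableT A mA).
move=> C mC; have := mF measurableT C mC; by rewrite setTI.
Qed.

End cylinder.

Section iid.
Context (R : realType) (d d' : measure_display) (T : measurableType d)
  (X : measurableType d') (P : probability T R) (e : int -> T -> X).
Hypothesis e_iid : iid P e.

Lemma iid_measurable k : measurable_fun setT (e k). Proof. by case: e_iid. Qed.

(** A pi-system that generates the product sigma-algebra, and on which independence computes the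
    law. *)
Let finite_cylinders : set (set (int -> X)) :=
  [set C | exists (J : seq int) (A : int -> set X),
     [/\ uniq J, (forall k, measurable (A k)), (forall k, k \notin J -> A k = setT) &
     C = [set f | forall k, A k (f k)]]].

Let P_finite_cylinder (h : int) (J : seq int) (A : int -> set X) :
  uniq J -> (forall k, measurable (A k)) -> (forall k, k \notin J -> A k = setT) ->
  P [set w | forall k, A k (e (k + h) w)] = \big[*%E/1%E]_(k <- J) P (e 0 @^-1` A k).
Proof.
move=> uJ mA AT; have [me eP eI] := e_iid.
have -> : [set w | forall k, A k (e (k + h) w)] =
    \big[setI/setT]_(k <- map (fun k => k + h) J) (e k @^-1` A (k - h)).
  rewrite big_map -bigcap_seq; apply/seteqP; split => w /=.
    by move=> H k /= kJ; rewrite addrK.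
  move=> H k; have [kJ|kJ] := boolP (k \in J); last by rewrite AT.
  by have := H k kJ; rewrite /= addrK.
rewrite (eI _ (fun k => A (k - h))); last by [].
  rewrite big_map; apply: eq_bigr => k _.
  by rewrite addrK (eP (k + h)).
by rewrite map_inj_uniq//; exact: addIr.
Qed.

(** On finite cylinders both laws are the same product of marginals, whatever the shift; measures
    that agree on a generating pi-system are equal. *)
Lemma iid_shift (h : int) (C : set (int -> X)) : <<s @cylinders int d' X >> C ->
  P [set w | C (fun k => e (k + h) w)] = P [set w | C (fun k => e k w)].
Proof.
move=> mC.
pose S := g_sigma_algebraType (@cylinders int d' X).
have mF (h' : int) : measurable_fun setT ((fun w k => e (k + h') w) : T -> S).
  move=> _ B mB; rewrite setTI.
  by apply: (measurable_cylinder_map (e := fun k => e (k + h'))) => // k; exact: iid_measurable.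
(* The unshifted law is written as the shift by 0, so that [P_finite_cylinder] computes both
   sides. *)
have -> : P [set w | C (fun k => e k w)] = P [set w | C (fun k => e (k + 0) w)].
  congr (P _); apply/funext => w; rewrite /mkset; congr C.
  by apply/funext => k; rewrite addr0.
have sub : @measurable _ S = <<s finite_cylinders >>.
  apply/seteqP; split; apply: smallest_sub.
  - exact: smallest_sigma_algebra.
  - move=> _ [i [A [mA ->]]]; apply: sub_gen_smallest.
    exists [:: i], (fun k => if k == i then A else setT); split => //.
    + by move=> k; case: ifP.
    + by move=> k; rewrite inE => /negbTE ->.
    + apply/seteqP; split => f /= Af; last by have := Af i; rewrite eqxx.
      by move=> k; case: ifP => // /eqP ->.
  - exact: smallest_sigma_algebra.
  - move=> _ [J [A [_ mA _ ->]]].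
    rewrite (_ : [set f | _] = \bigcap_n [set f : int -> X |
        A n%:Z (f n%:Z)] `&` \bigcap_n [set f : int -> X | A (- n%:Z) (f (- n%:Z))]).
      apply: (@measurableI _ S); apply: (@bigcapT_measurable _ S) => n.
        by apply: sub_gen_smallest; exists n%:Z, (A n%:Z).
      by apply: sub_gen_smallest; exists (- n%:Z), (A (- n%:Z)).
    apply/seteqP; split => f /=; first by move=> H; split => n _ /=.
    move=> [H1 H2] [n|n]; first exact: (H1 n I).
    by have := H2 n.+1 I; rewrite /= NegzE.
apply: (@measure_unique _ R S finite_cylinders (fun=> setT) sub _ _ _
   (pushforward P ((fun w k => e (k + h) w) : T -> S))
   (pushforward P ((fun w k => e (k + 0) w) : T -> S))) => //.
- move=> _ _ [J1 [A1 [u1 m1 t1 ->]]] [J2 [A2 [u2 m2 t2 ->]]].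
  exists (undup (J1 ++ J2)), (fun k => A1 k `&` A2 k); split.
  + exact: undup_uniq.
  + by move=> k; exact: measurableI.
  + move=> k; rewrite mem_undup mem_cat negb_or => /andP[k1 k2].
    by rewrite t1// t2// setTI.
  + apply/seteqP; split => f /=; first by move=> [H1 H2] k; split.
    by move=> H; split => k; have [] := H k.
- by move=> _; exists [::], (fun=> setT); split => //; apply/seteqP; split.
- by rewrite bigcup_const.
- move=> _ [J [A [uJ mA AT ->]]]; rewrite /pushforward/=.
  transitivity (\big[*%E/1%E]_(k <- J) P (e 0 @^-1` A k)).
    exact: P_finite_cylinder.
  exact/esym/P_finite_cylinder.
- move=> k; apply: (@le_lt_trans _ _ 1%E); last exact: ltry.
  exact: (probability_le1 P measurableT).
Qed.

(** A time shift of the process is a time shift of the noise, so an event about the process is one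
    event [C'] about the noise, to which [iid_shift] applies. *)
Lemma strictly_stationary_functional (d2 : measure_display) (Z : measurableType d2)
    (Psi : (nat -> X) -> Z) :
  measurable_functional Psi ->
  strictly_stationary P (fun k w => Psi (fun j => e (k - j%:Z) w)).
Proof.
move=> mPsi h C mC.
pose C' := [set f : int -> X | C (fun k => Psi (fun j => f (k - j%:Z)))].
pose S := g_sigma_algebraType (@cylinders int d' X).
have mC' : <<s @cylinders int d' X >> C'.
  apply: (@measurable_cylinder_map _ _ S Z int (fun k f => Psi (fun j => f (k - j%:Z)))) => //.
  move=> k _ B mB; rewrite setTI.
  apply: (@measurable_cylinder_map _ _ S X nat (fun j f => f (k - j%:Z)) _
    (Psi @^-1` B)); last exact: mPsi.
  move=> j _ A mA; rewrite setTI; apply: sub_gen_smallest.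
  by exists (k - j%:Z), A.
have := iid_shift h mC'; rewrite /C'/=.
rewrite (_ : [set w | C (fun k => Psi (fun j => e (k - j%:Z + h) w))] =
  [set w | C (fun k => Psi (fun j => e (k + h - j%:Z) w))])//.
apply/funext => w; rewrite /mkset; congr C; apply/funext => k; congr Psi.
by apply/funext => j; rewrite addrAC.
Qed.

Lemma iid_integral (f : X -> \bar R) k : measurable_fun setT f ->
  (forall x, 0 <= f x)%E -> (\int[P]_w f (e k w) = \int[P]_w f (e 0 w))%E.
Proof.
move=> mf f0.
rewrite -[LHS](@ge0_integral_pushforward _ _ _ _ _ (e k) (iid_measurable k) P setT f)//.
rewrite -[RHS](@ge0_integral_pushforward _ _ _ _ _ (e 0) (iid_measurable 0) P setT f)//.
apply: eq_measure_integral; [exact: iid_measurable|exact: iid_measurable|].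
by move=> m1 m2 A mA _; have [_ h _] := e_iid; exact: h.
Qed.

Import HBNNSimple.

(** Replaces an indicator of [e k] by a function of [e k], through simple functions and monotone
    convergence. The weight [H] carries all other factors of a product. *)
Let integral_indep_ext (H : T -> R) k (c : R) (f : X -> R) :
  measurable_fun setT H -> (forall w, 0 <= H w) -> 0 <= c ->
  measurable_fun setT f -> (forall x, 0 <= f x) ->
  (forall A, measurable A ->
     \int[P]_w (H w * \1_A (e k w))%:E = c%:E * P (e k @^-1` A))%E ->
  (\int[P]_w (H w * f (e k w))%:E = c%:E * \int[P]_w (f (e k w))%:E)%E.
Proof.
move=> mH H0 c0 mf f0 HA.
have mf' : measurable_fun setT (EFin \o f) by exact/measurable_EFinP.
pose g := nnsfun_approx measurableT mf'.
have mek := iid_measurable k.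
have mge n : measurable_fun setT (fun w => g n (e k w)).
  by apply: measurableT_comp => //; exact: measurable_funPT.
have gcv x : (g n x)%:E @[n --> \oo] --> (f x)%:E.
  by apply: (cvg_nnsfun_approx measurableT mf') => // y _; rewrite lee_fin.
have gstep n : (\int[P]_w (H w * g n (e k w))%:E = c%:E * \int[P]_w (g n (e k w))%:E)%E.
  have [s gE s0] : exists2 s : seq R,
      forall x, g n x = \sum_(y <- s) y * \1_(g n @^-1` [set y]) x &
      forall y, y \in s -> 0 <= y.
    have /finite_seqP[s0 s0E] := @fimfunP _ _ (g n).
    have sE : range (g n) = [set` undup s0].
      by rewrite s0E; apply/seteqP; split => y /=; rewrite mem_undup.
    exists (undup s0) => [x|y ys]; first by rewrite fimfunE sE -fsbig_seq ?undup_uniq.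
    have : [set` undup s0] y by [].
    by rewrite -sE => -[x _ <-].
  pose B y := g n @^-1` [set y].
  have mB y : measurable (B y) by exact: measurable_sfunP.
  (* No sign of [y] is required: where the indicator is 1, [y] is a value of [g n]. *)
  have y1 y x : 0 <= y * \1_(B y) x.
    rewrite indicE; have [|] := boolP (x \in B y); last by rewrite mulr0.
    by rewrite inE /B/= => <-; rewrite mulr1.
  have mi y : measurable_fun setT (fun w => \1_(B y) (e k w) : R).
    by apply: measurableT_comp => //; exact: measurable_indic.
  have -> : (\int[P]_w (H w * g n (e k w))%:E =
      \int[P]_w \sum_(y <- s) (y * (H w * \1_(B y) (e k w)))%:E)%E.
    apply: eq_integral => w _; rewrite gE mulr_sumr -sumEFin.
    by apply: eq_bigr => y _; rewrite mulrCA.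
  have -> : (\int[P]_w (g n (e k w))%:E =
      \int[P]_w \sum_(y <- s) (y * \1_(B y) (e k w))%:E)%E.
    by apply: eq_integral => w _; rewrite gE -sumEFin.
  rewrite !ge0_integral_sum//; last 4 first.
  - by move=> y; apply/measurable_EFinP/measurable_funM.
  - by move=> y w _; rewrite lee_fin.
  - by move=> y; apply/measurable_EFinP/measurable_funM => //; exact: measurable_funM.
  - by move=> y w _; rewrite lee_fin mulrCA mulr_ge0.
  rewrite ge0_sume_distrr; last first.
    by move=> y _; apply: integral_ge0 => w _; rewrite lee_fin.
  rewrite big_seq [RHS]big_seq; apply: eq_bigr => y ys.
  under eq_integral do rewrite EFinM.
  rewrite ge0_integralZl//; last 3 first.
  - by apply/measurable_EFinP/measurable_funM.
  - by move=> w _; rewrite lee_fin mulr_ge0.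
  - by rewrite lee_fin s0.
  under [in RHS]eq_integral do rewrite EFinM.
  rewrite HA// ge0_integralZl//; first last.
  - by rewrite lee_fin s0.
  - exact/measurable_EFinP.
  rewrite muleCA; congr (_ * (_ * _))%E.
  rewrite (_ : (fun w => _) = (fun w => (\1_(e k @^-1` B y) w)%:E)).
    by rewrite integral_indic ?setIT// -[X in measurable X]setTI; exact: mek.
  by apply/funext => w; rewrite !indicE.
have l1 : (\int[P]_w (H w * g n (e k w))%:E @[n --> \oo] -->
    \int[P]_w (H w * f (e k w))%:E)%E.
  have -> : (\int[P]_w (H w * f (e k w))%:E = \int[P]_w limn (fun n => (H w * g n (e k w))%:E))%E.
    apply: eq_integral => w _; apply/esym/cvg_lim => //.
    under eq_fun do rewrite EFinM; rewrite EFinM.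
    by apply: cvgeZl => //; exact: gcv.
  apply: cvg_monotone_convergence => //.
  - by move=> n; apply/measurable_EFinP/measurable_funM.
  - by move=> n w _; rewrite lee_fin mulr_ge0.
  - move=> w _ m n mn; rewrite lee_fin ler_wpM2l//.
    by have /lefP := nd_nnsfun_approx measurableT mf' mn; exact.
have l2 : (c%:E * \int[P]_w (g n (e k w))%:E @[n --> \oo] -->
    c%:E * \int[P]_w (f (e k w))%:E)%E.
  apply: cvgeZl => //.
  have -> : (\int[P]_w (f (e k w))%:E = \int[P]_w limn (fun n => (g n (e k w))%:E))%E.
    by apply: eq_integral => w _; apply/esym/cvg_lim => //; exact: gcv.
  apply: cvg_monotone_convergence => //.
  - by move=> n; apply/measurable_EFinP.
  - by move=> n w _; rewrite lee_fin.
  - move=> w _ m n mn; rewrite lee_fin.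
    by have /lefP := nd_nnsfun_approx measurableT mf' mn; exact.
rewrite -(cvg_lim _ l1)//; under eq_fun do rewrite gstep.
exact: cvg_lim l2.
Qed.

(** Independence is given for events only. The induction treats mixed products, with [f] on [J1] and
    indicators on [J2], and turns one indicator into [f] at each step. *)
Lemma iid_integral_prod (f : X -> R) (rho : R) (J : seq int) :
  measurable_fun setT f -> (forall x, 0 <= f x) ->
  (\int[P]_w (f (e 0 w))%:E = rho%:E)%E -> uniq J ->
  (\int[P]_w (\prod_(k <- J) f (e k w))%:E = (rho ^+ size J)%:E)%E.
Proof.
move=> mf f0 frho.
have rho0 : 0 <= rho by rewrite -lee_fin -frho; apply: integral_ge0 => w _; rewrite lee_fin.
have fk k : (\int[P]_w (f (e k w))%:E = rho%:E)%E.
  by rewrite (@iid_integral (EFin \o f))//; exact/measurable_EFinP.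
have mprod (K : seq int) : measurable_fun setT (fun w => \prod_(k <- K) f (e k w)).
  apply: measurable_prod => k _; apply: measurableT_comp => //; exact: iid_measurable.
have mprodi (A : int -> set X) (K : seq int) : (forall k, measurable (A k)) ->
    measurable_fun setT (fun w => \prod_(k <- K) \1_(A k) (e k w) : R).
  move=> mA; apply: measurable_prod => k _; apply: measurableT_comp.
    exact: measurable_indic.
  exact: iid_measurable.
have key (J1 J2 : seq int) (A : int -> set X) : uniq (J1 ++ J2) ->
    (forall k, measurable (A k)) ->
    (\int[P]_w ((\prod_(k <- J1) f (e k w)) * \prod_(k <- J2) \1_(A k) (e k w))%:E =
    (rho ^+ size J1)%:E * \prod_(k <- J2) P (e k @^-1` A k))%E.
  elim: J1 J2 A => [|k J1 IH] J2 A.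
    move=> uJ mA; rewrite expr0 mul1e.
    have [me eP eI] := e_iid.
    rewrite -eI//.
    rewrite (_ : (fun w => _) = (fun w =>
      (\1_(\big[setI/setT]_(k <- J2) (e k @^-1` A k)) w)%:E)).
      rewrite integral_indic ?setIT//; apply: bigsetI_measurable => k _.
      by rewrite -[X in measurable X]setTI; exact: me.
    apply/funext => w; rewrite big_nil mul1r; congr EFin.
    elim: J2 {uJ} => [|j J2 IH]; first by rewrite !big_nil indicT.
    by rewrite !big_cons IH indicI.
  move=> /=/andP[kJ uJ] mA.
  under eq_integral do rewrite big_cons -mulrA mulrC.
  have pfin (K : seq int) : (\prod_(j <- K) P (e j @^-1` A j))%E \is a fin_num.
    apply: (big_ind (fun x : \bar R => x \is a fin_num)) => //.
      by move=> x y; exact: fin_numM.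
    move=> j _; apply: fin_num_measure.
    by rewrite -[X in measurable X]setTI; exact: iid_measurable.
  have p0 (K : seq int) : (0 <= \prod_(j <- K) P (e j @^-1` A j))%E.
    by apply: prode_ge0 => j _; exact: measure_ge0.
  rewrite (@integral_indep_ext _ k (rho ^+ size J1 * fine (\prod_(k <- J2) P (e k @^-1` A k))%E)).
  - rewrite fk EFinM fineK// -muleA [X in (_ * X)%E]muleC muleA -EFinM.
    by rewrite exprSr.
  - by apply: measurable_funM => //; exact: mprodi.
  - by move=> w; rewrite mulr_ge0// prodr_ge0// => j _; rewrite indicE.
  - by rewrite mulr_ge0 ?exprn_ge0// fine_ge0.
  - by [].
  - by [].
  - move=> B mB.
    (* The induction hypothesis is used with the test event [B] at time [k]; as [k] is not in [J2],
       the other factors keep their events. *)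
    pose A' j := if j == k then B else A j.
    have kJ2 : k \notin J2 by move: kJ; rewrite mem_cat negb_or => /andP[].
    have := IH (k :: J2) A' _ _.
    rewrite big_cons /A' eqxx.
    have -> : (\prod_(j <- J2) P (e j @^-1` (if j == k then B else A j)) =
        \prod_(j <- J2) P (e j @^-1` A j))%E.
      rewrite big_seq [RHS]big_seq; apply: eq_bigr => j jJ2.
      by case: eqP => // jk; move: kJ2; rewrite -jk jJ2.
    rewrite EFinM fineK// muleAC -muleA => <-.
    + apply: eq_integral => w _; rewrite big_cons eqxx -mulrA; congr (_ * _)%:E.
      rewrite mulrC; congr (_ * _).
      rewrite big_seq [RHS]big_seq; apply: eq_bigr => j jJ2.
      by case: eqP => // jk; move: kJ2; rewrite -jk jJ2.
    + by rewrite -[k :: J2]cat1s uniq_catCA /= kJ.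
    + by move=> j; case: ifP.
move=> uJ; have := key J [::] (fun=> setT); rewrite cats0 big_nil mule1 => <-//.
by apply: eq_integral => w _; rewrite big_nil mulr1.
Qed.

End iid.

(** * The minimal solution *)

Section mkL2.
Variable R : realType.

Lemma mkL2_subproof (phi : R -> R) : exists x : L2 R,
  measurable_fun setT phi -> (\int[leb01 R]_t (phi t ^+ 2)%:E < +oo)%E ->
  {ae leb01 R, forall t, x t = phi t}.
Proof.
have [[mphi phifin]|h] := pselect (measurable_fun setT phi /\
    (\int[leb01 R]_t (phi t ^+ 2)%:E < +oo)%E).
  by have [x xE] := L2_ex mphi phifin; exists x.
by exists point => m f; exfalso; apply: h.
Qed.

Definition sqint (phi : R -> R) : \bar R := (\int[leb01 R]_t (phi t ^+ 2)%:E)%E.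

(* The class of [phi], or of [0] when [phi] is not square integrable. *)
Definition mkL2 (phi : R -> R) : L2 R :=
  sval (cid (mkL2_subproof (if (sqint phi < +oo)%E then phi else cst 0))).

Lemma mkL2E (phi : R -> R) : measurable_fun setT phi -> (sqint phi < +oo)%E ->
  {ae leb01 R, forall t, mkL2 phi t = phi t}.
Proof.
move=> mphi fphi; rewrite /mkL2 fphi; case: cid => x /= h; exact: h.
Qed.

Lemma measurable_sqint (d : measure_display) (T : measurableType d)
    (phi : T * measurableTypeR R -> measurableTypeR R) : measurable_fun setT phi ->
  measurable_fun setT (fun w => sqint (fun t => phi (w, t))).
Proof.
move=> mphi; apply: (@measurable_integral01 R _ T (fun wt => (phi wt ^+ 2)%:E)).
  exact/measurable_EFinP/measurable_funX.
by move=> wt; rewrite lee_fin sqr_ge0.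
Qed.

(** The fallback to 0 happens on a measurable set of [w], so [phi] cut off there is a jointly
    measurable representative. *)
Lemma measurable_mkL2 (d : measure_display) (T : measurableType d)
    (phi : T * measurableTypeR R -> measurableTypeR R) : measurable_fun setT phi ->
  measurable_fun setT (fun w => mkL2 (fun t => phi (w, t))).
Proof.
move=> mphi.
have mS := measurable_sqint mphi.
pose D := [set wt : T * measurableTypeR R | (sqint (fun t => phi (wt.1, t)) < +oo)%E].
have mD : measurable D.
  have m1 : measurable_fun setT (fun wt : T * measurableTypeR R => sqint (fun t => phi (wt.1, t))).
    exact: (measurableT_comp mS).
  by rewrite -[X in measurable X]setTI; exact: emeasurable_fun_infty_o.
apply: (@measurable_fun_L2 _ _ _ (phi \_ D)).
  by apply/(measurable_restrictT _ mD); exact: measurable_funTS.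
move=> w; have mphiw : measurable_fun setT (fun t => phi (w, t)).
  by apply: measurableT_comp => //; apply: measurable_fun_pair => //; exact: measurable_cst.
have [fin|inf] := boolP (sqint (fun t => phi (w, t)) < +oo)%E.
  apply: ae01S (mkL2E mphiw fin) => t ->.
  by rewrite patchT// inE.
rewrite /mkL2 (negbTE inf); case: cid => x /= h.
apply: ae01S (h _ _).
- by move=> t ->; rewrite patchN// notin_setE /D/= ; exact/negP.
- exact: measurable_cst.
- by rewrite (_ : (fun t => _) = cst 0%E) ?integral0 ?ltry//; apply/funext => t /=; rewrite expr0n.
Qed.

End mkL2.

(** * The increasing iterates and their limit *)

Section volatility.
Variables (R : realType) (b : R -> R -> R).
Hypothesis mb : measurable_fun setT (fun ts : measurableTypeR R * measurableTypeR R =>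
                         b ts.1 ts.2 : measurableTypeR R).
Variable delta : L2 R.

Definition delta_pos (t : R) : R := Num.max (delta t) 0.

Lemma delta_pos_ge0 t : 0 <= delta_pos t.
Proof. by rewrite /delta_pos le_max lexx orbT. Qed.

Lemma measurable_delta_pos : measurable_fun setT delta_pos.
Proof. by apply: measurable_maxr; [exact: measurable_L2|exact: measurable_cst]. Qed.

Definition shiftf (f : nat -> L2 R) : nat -> L2 R := fun j => f j.+1.

(* [vol n f] is sigma^2 computed from the past noise [f], where [f j] stands for
   eps_(k-1-j), with sigma^2 set to [0] [n] steps earlier. *)
Fixpoint vol (n : nat) (f : nat -> L2 R) (t : R) : \bar R :=
  if n is n'.+1 then
    ((delta_pos t)%:E + arch_op b (fun s => L2_eval (f 0%N, s)) (vol n' (shiftf f)) t)%E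
  else 0%E.

Lemma vol_ge0 n f t : (0 <= vol n f t)%E.
Proof.
elim: n f t => //= n IH f t; apply: adde_ge0.
  by rewrite lee_fin delta_pos_ge0.
exact: arch_op_ge0.
Qed.

Notation SeqL2 := (g_sigma_algebraType (@cylinders nat _ (L2 R))).

Lemma measurable_seq_coord j : measurable_fun setT (fun f : SeqL2 => f j).
Proof.
by move=> _ A mA; rewrite setTI; apply: sub_sigma_algebra; exists j, A.
Qed.

Lemma measurable_shiftf : measurable_fun setT (shiftf : SeqL2 -> SeqL2).
Proof.
apply: (@measurability _ _ SeqL2 SeqL2 setT shiftf (@cylinders nat _ (L2 R))) => //.
move=> _ [_ [i [A [mA ->]]] <-]; rewrite setTI.
by apply: sub_sigma_algebra; exists i.+1, A.
Qed.

Lemma measurable_eval_coord j : measurable_fun setT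
  (fun fs : SeqL2 * measurableTypeR R => L2_eval (fs.1 j, fs.2)).
Proof.
apply: (measurableT_comp (@measurable_L2_eval R)).
apply: measurable_fun_pair => //.
by apply: (measurableT_comp (measurable_seq_coord j)).
Qed.

Lemma measurable_vol n : measurable_fun setT
  (fun ft : SeqL2 * measurableTypeR R => vol n ft.1 ft.2).
Proof.
elim: n => [|n IH] /=; first exact: measurable_cst.
apply: emeasurable_funD.
  by apply/measurable_EFinP; apply: measurableT_comp => //; exact: measurable_delta_pos.
apply: (measurable_arch_op_par mb (e := fun fs : SeqL2 * measurableTypeR R => L2_eval (fs.1 0%N, fs.2))
  (u := fun fs : SeqL2 * measurableTypeR R => vol n (shiftf fs.1) fs.2)).
- exact: measurable_eval_coord.
- apply: (measurableT_comp IH (g := fun fs : SeqL2 * measurableTypeR R => (shiftf fs.1 : SeqL2, fs.2))).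
  apply: measurable_fun_pair => //.
  exact: (measurableT_comp measurable_shiftf).
- by move=> x; exact: vol_ge0.
Qed.

Lemma measurable_section (d : measure_display) (T : measurableType d) (d' : measure_display)
    (Y : measurableType d') (F : T * measurableTypeR R -> Y) (x : T) :
  measurable_fun setT F -> measurable_fun setT (fun t : R => F (x, t)).
Proof.
move=> mF; have m0 : measurable_fun setT (fun t : measurableTypeR R => (x, t)).
  by apply: measurable_fun_pair => //; exact: measurable_cst.
exact: (measurableT_comp mF m0).
Qed.

Lemma measurable_vol_section n f : measurable_fun setT (vol n f).
Proof. exact: (measurable_section (f : SeqL2) (measurable_vol n)). Qed.

Lemma measurable_eval (x : L2 R) : measurable_fun setT (fun s => L2_eval (x, s)).
Proof. exact: (measurable_section x (@measurable_L2_eval R)). Qed.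

Lemma le_arch_op (e : R -> R) (u w : R -> \bar R) t :
  measurable_fun setT e -> measurable_fun setT u -> measurable_fun setT w ->
  (forall s, 0 <= u s)%E -> (forall s, 0 <= w s)%E ->
  {ae leb01 R, forall s, (u s <= w s)%E} -> (arch_op b e u t <= arch_op b e w t)%E.
Proof.
move=> me mu mw u0 w0 uw.
have mk : measurable_fun setT (fun s => (pos_kernel b t s * e s ^+ 2)%:E).
  apply/measurable_EFinP/measurable_funM; last exact: measurable_funX.
  by apply: measurable_maxr; [exact: measurable_kernel_section|exact: measurable_cst].
have k0 s : (0 <= (pos_kernel b t s * e s ^+ 2)%:E)%E.
  by rewrite lee_fin mulr_ge0 ?pos_kernel_ge0 ?sqr_ge0.
apply: ae_ge0_le_integral => //.
- by move=> s _; exact: mule_ge0.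
- exact: emeasurable_funM.
- by move=> s _; exact: mule_ge0.
- exact: emeasurable_funM.
- by apply: ae01S uw => s us _; exact: lee_wpmul2l.
Qed.

Lemma vol_nd f t : {homo (fun n => vol n f t) : m n / (m <= n)%N >-> (m <= n)%E}.
Proof.
apply/nondecreasing_seqP => n; elim: n f t => [|n IH] f t; first exact: vol_ge0.
rewrite [vol n.+1 _ _]/= [vol n.+2 _ _]/=; apply: leeD => //.
apply: le_arch_op.
- exact: measurable_eval.
- exact: measurable_vol_section.
- exact: (@measurable_vol_section n.+1).
- by move=> s; exact: vol_ge0.
- by move=> s; exact: (@vol_ge0 n.+1).
- by apply: aeW => s; exact: IH.
Qed.

Definition vol_lim f t : \bar R := limn (fun n => vol n f t).

Lemma vol_cvg f t : vol n f t @[n --> \oo] --> vol_lim f t.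
Proof. exact: ereal_nondecreasing_is_cvgn (@vol_nd f t). Qed.

Lemma vol_lim_ge0 f t : (0 <= vol_lim f t)%E.
Proof.
by apply: lime_ge; [exact: vol_cvg|apply: nearW => n; exact: vol_ge0].
Qed.

Lemma measurable_vol_lim : measurable_fun setT
  (fun ft : SeqL2 * measurableTypeR R => vol_lim ft.1 ft.2).
Proof.
apply: (emeasurable_fun_cvg (fun n (ft : SeqL2 * measurableTypeR R) => vol n ft.1 ft.2)).
  exact: measurable_vol.
by move=> ft _; exact: vol_cvg.
Qed.

Lemma measurable_vol_lim_section f : measurable_fun setT (vol_lim f).
Proof. exact: (measurable_section (f : SeqL2) measurable_vol_lim). Qed.

(** Monotone convergence under the integral: the fixed-point equation holds for every noise sequence
    and every [t], infinite values included. *)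
Lemma vol_lim_eq f t : vol_lim f t =
  ((delta_pos t)%:E + arch_op b (fun s => L2_eval (f 0%N, s)) (vol_lim (shiftf f)) t)%E.
Proof.
apply/cvg_lim => //; rewrite -cvg_shiftS /=.
apply: cvgeD; first by rewrite fin_num_adde_defr.
  exact: cvg_cst.
have mk : measurable_fun setT (fun s => (pos_kernel b t s * L2_eval (f 0%N, s) ^+ 2)%:E).
  apply/measurable_EFinP/measurable_funM; last first.
    by apply: measurable_funX; exact: measurable_eval.
  by apply: measurable_maxr; [exact: measurable_kernel_section|exact: measurable_cst].
have k0 s : (0 <= (pos_kernel b t s * L2_eval (f 0%N, s) ^+ 2)%:E)%E.
  by rewrite lee_fin mulr_ge0 ?pos_kernel_ge0 ?sqr_ge0.
rewrite /arch_op.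
have -> : (\int[leb01 R]_s ((pos_kernel b t s * L2_eval (f 0%N, s) ^+ 2)%:E * vol_lim (shiftf f) s) =
  \int[leb01 R]_s limn (fun n =>
    (pos_kernel b t s * L2_eval (f 0%N, s) ^+ 2)%:E * vol n (shiftf f) s))%E.
  apply: eq_integral => s _; apply/esym/cvg_lim => //.
  by apply: cvgeZl => //; exact: vol_cvg.
apply: cvg_monotone_convergence => //.
- by move=> n; apply: emeasurable_funM => //; exact: measurable_vol_section.
- by move=> n s _; apply: mule_ge0 => //; exact: vol_ge0.
- by move=> s _ m n mn; apply: lee_wpmul2l => //; exact: vol_nd.
Qed.

Definition sqnorm (u : R -> \bar R) : \bar R := (\int[leb01 R]_t (u t * u t))%E.

Definition sqK (e : R -> R) : \bar R :=
  (\int[leb01 R]_t \int[leb01 R]_s (b t s ^+ 2 * e s ^+ 4)%:E)%E.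

(** Minkowski and the operator bound give [N_n(f) <= A + kappa_0 N_(n-1)(shiftf f)] for the norms;
    unfolding produces the sum of products, the empty one included. *)
Lemma vol_bound n f (A : R) (kappa : nat -> R) : 0 <= A ->
  (sqnorm (EFin \o delta_pos) <= (A ^+ 2)%:E)%E -> (forall j, 0 <= kappa j) ->
  (forall j, sqK (fun s => L2_eval (f j, s)) <= (kappa j ^+ 2)%:E)%E ->
  (sqnorm (vol n f) <= ((A * \sum_(m < n) \prod_(i < m) kappa i) ^+ 2)%:E)%E.
Proof.
move=> A0 hA; elim: n f kappa => [|n IH] f kappa kappa0 hK.
  rewrite /sqnorm/=; under eq_integral do rewrite mule0.
  by rewrite integral0 lee_fin sqr_ge0.
have {}IH := IH (shiftf f) (fun j => kappa j.+1) (fun j => kappa0 j.+1) (fun j => hK j.+1).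
have s0 : 0 <= A * \sum_(m < n) \prod_(i < m) kappa i.+1.
  by rewrite mulr_ge0// sumr_ge0// => m _; rewrite prodr_ge0.
(* The term [m = 0] is the empty product; the factor [kappa 0] comes out of all others. *)
have -> : A * \sum_(m < n.+1) \prod_(i < m) kappa i =
    A + kappa 0%N * (A * \sum_(m < n) \prod_(i < m) kappa i.+1).
  rewrite big_ord_recl big_ord0 mulrDr mulr1; congr (_ + _).
  rewrite mulrCA; congr (_ * _); rewrite mulr_sumr; apply: eq_bigr => m _.
  by rewrite big_ord_recl.
rewrite /sqnorm/=; apply: ge0_minkowski2 => //.
- by apply/measurable_EFinP; exact: measurable_delta_pos.
- apply: measurable_arch_op => //.
  + exact: measurable_eval.
  + exact: measurable_vol_section.
  + by move=> s; exact: vol_ge0.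
- by move=> t; rewrite lee_fin delta_pos_ge0.
- by move=> t; apply: arch_op_ge0 => s; exact: vol_ge0.
- by rewrite mulr_ge0.
apply: le_trans (arch_op_bound mb _ _ _) _.
- exact: measurable_eval.
- exact: measurable_vol_section.
- by move=> s; exact: vol_ge0.
rewrite exprMn EFinM; apply: lee_pmul => //.
- apply: integral_ge0 => t _; apply: integral_ge0 => s _.
  by rewrite lee_fin mulr_ge0 ?sqr_ge0// (exprM _ 2 2) sqr_ge0.
- by apply: integral_ge0 => t _; rewrite mule_ge0// vol_ge0.
- exact: hK.
Qed.

Lemma vol_lim_sqnorm f (B : R) :
  (forall n, sqnorm (vol n f) <= B%:E)%E -> (sqnorm (vol_lim f) <= B%:E)%E.
Proof.
move=> h; rewrite /sqnorm.
have -> : (\int[leb01 R]_t (vol_lim f t * vol_lim f t) =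
    \int[leb01 R]_t limn (fun n => vol n f t * vol n f t))%E.
  apply: eq_integral => t _; apply/esym/cvg_lim => //.
  have := @vol_cvg f t; have := vol_lim_ge0 f t.
  case E : (vol_lim f t) => [r| |]// _ c.
    by apply: cvgeM => //; rewrite /mule_def/= ?orbT.
  by apply: cvgeM => //; rewrite /mule_def.
rewrite monotone_convergence//.
- apply: lime_le; last by apply: nearW => n; exact: h.
  apply: ereal_nondecreasing_is_cvgn => m n mn; apply: ge0_le_integral => //.
  + by move=> t _; rewrite mule_ge0// vol_ge0.
  + by apply: emeasurable_funM; exact: measurable_vol_section.
  + by apply: emeasurable_funM; exact: measurable_vol_section.
  + by move=> t _; apply: lee_pmul; rewrite ?vol_ge0// vol_nd.
- by move=> n; apply: emeasurable_funM; exact: measurable_vol_section.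
- by move=> n t _; rewrite mule_ge0// vol_ge0.
- by move=> t _ m n mn; apply: lee_pmul; rewrite ?vol_ge0// vol_nd.
Qed.

(** Here [w j] is a solution [j] steps back. Any solution lies above the start value 0, and the
    operator is monotone; the induction varies [f] and [w] because each step moves both into the
    past. *)
Lemma vol_lim_le f (w : nat -> R -> \bar R) :
  (forall j, measurable_fun setT (w j)) -> (forall j t, 0 <= w j t)%E ->
  (forall j, {ae leb01 R, forall t, w j t = ((delta_pos t)%:E +
      arch_op b (fun s => L2_eval (f j, s)) (w j.+1) t)%E}) ->
  {ae leb01 R, forall t, (vol_lim f t <= w 0%N t)%E}.
Proof.
move=> mw w0 wE.
have h n : {ae leb01 R, forall t, (vol n f t <= w 0%N t)%E}.
  elim: n f w mw w0 wE => [|n IH] f w mw w0 wE.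
    by apply: aeW => t; exact: w0.
  have {}IH := IH (shiftf f) (fun j => w j.+1) (fun j => mw j.+1) (fun j => w0 j.+1) (fun j => wE j.+1).
  apply: ae01S (wE 0%N) => t -> /=; apply: leeD => //.
  apply: le_arch_op => //.
  - exact: measurable_eval.
  - exact: measurable_vol_section.
  - by move=> s; exact: vol_ge0.
have {}h : {ae leb01 R, forall t, forall n, (vol n f t <= w 0%N t)%E}.
  by apply: ae_foralln => n; exact: h.
apply: ae01S h => t ht.
by apply: lime_le; [exact: vol_cvg|apply: nearW].
Qed.

End volatility.

Lemma measurable_sqrtr (R : realType) : measurable_fun setT (@Num.sqrt R).
Proof. by apply: continuous_measurable_fun; exact: sqrt_continuous. Qed.

(** * Solutions along one noise sequence *)

Section path.
Variables (R : realType) (b : R -> R -> R) (delta : L2 R).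
Hypothesis delta_ge0 : L2_nonneg delta.
Hypothesis b_ge0 : nonneg_kernel_op b.
Hypothesis b_bounded : bounded_kernel_op b.
Let mb := b_bounded.1.

Lemma ae_delta_pos : {ae leb01 R, forall t, delta_pos delta t = delta t}.
Proof. by apply: ae01S delta_ge0 => t ht; rewrite /delta_pos max_l. Qed.

Variable e : int -> L2 R.

Definition past (k : int) : nat -> L2 R := fun j => e (k - 1 - j%:Z).

Lemma past0 k : past k 0%N = e (k - 1).
Proof. by rewrite /past subr0. Qed.

Lemma shiftf_past k : shiftf (past k) = past (k - 1).
Proof. by apply/funext => j; rewrite /shiftf /past; congr e; lia. Qed.

(** A representative of a non-negative class may be negative on a null set; its positive part can be
    fed to [arch_op]. *)
Definition ppart (x : L2 R) (t : R) : \bar R := (Num.max (x t) 0)%:E.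

Lemma ppart_ge0 x t : (0 <= ppart x t)%E.
Proof. by rewrite /ppart lee_fin le_max lexx orbT. Qed.

Lemma measurable_ppart x : measurable_fun setT (ppart x).
Proof.
apply/measurable_EFinP/measurable_maxr; last exact: measurable_cst.
exact: measurable_L2.
Qed.

Lemma ppartE x : L2_nonneg x -> {ae leb01 R, forall t, ppart x t = (x t)%:E}.
Proof. by move=> x0; apply: ae01S x0 => t xt; rewrite /ppart max_l. Qed.

(** The ARCH equations for one sample point, with [y] eliminated and all integrands non-negative;
    [path_solP] is the translation. *)
Definition path_sol (v : int -> L2 R) : Prop :=
  (forall k, L2_nonneg (v k)) /\
  (forall k, {ae leb01 R, forall t, ppart (v k) t = ((delta_pos delta t)%:E +
     arch_op b (fun s => L2_eval (e (k - 1)%R, s)) (ppart (v (k - 1)%R)) t)%E}).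

Lemma kernel_op_sol (ek vk : L2 R) (z : R -> R) : L2_nonneg vk ->
  measurable_fun setT z ->
  {ae leb01 R, forall s, z s = (ek s * Num.sqrt (vk s)) ^+ 2} ->
  {ae leb01 R, forall t, kernel_op b z t =
    arch_op b (fun s => L2_eval (ek, s)) (ppart vk) t}.
Proof.
move=> vk0 mz zE.
apply: (@kernel_op_arch_op R b mb b_ge0 b_bounded (fun s => L2_eval (ek, s)) vk).
- exact: measurable_eval.
- exact: measurable_L2.
- exact: measurable_ppart.
- exact: mz.
- apply: ae01S3 zE (L2_evalE ek) vk0 => s -> -> vs.
  by rewrite exprMn sqr_sqrtr.
- by apply: ae01S (ppartE vk0) => s ->.
Qed.

Lemma kernel_op_sqr_ae (ek vk yk : L2 R) t :
  {ae leb01 R, forall s, yk s = ek s * Num.sqrt (vk s)} ->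
  kernel_op b (fun s => yk s ^+ 2) t =
  kernel_op b (fun s => (ek s * Num.sqrt (vk s)) ^+ 2) t.
Proof.
move=> yE; have mbt := measurable_kernel_section mb t.
apply: ae01_eq_integral; last by apply: ae01S yE => s ->.
- apply/measurable_EFinP/measurable_funM => //.
  by apply: measurable_funX; exact: measurable_L2.
- apply/measurable_EFinP/measurable_funM => //; apply: measurable_funX.
  apply: measurable_funM; first exact: measurable_L2.
  by apply: measurableT_comp; [exact: measurable_sqrtr|exact: measurable_L2].
Qed.

Lemma path_solP (v : int -> L2 R) : (forall k, L2_nonneg (v k)) ->
  (forall k, {ae leb01 R, forall t, (v k t)%:E = ((delta t)%:E +
    kernel_op b (fun s => (e (k - 1) s * Num.sqrt (v (k - 1) s)) ^+ 2)%R t)%E}) <->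
  path_sol v.
Proof.
move=> v0.
have kE k : {ae leb01 R, forall t,
    kernel_op b (fun s => (e (k - 1) s * Num.sqrt (v (k - 1) s)) ^+ 2) t =
    arch_op b (fun s => L2_eval (e (k - 1), s)) (ppart (v (k - 1))) t}.
  apply: kernel_op_sol => //; last exact: aeW.
  apply: measurable_funX; apply: measurable_funM; first exact: measurable_L2.
  by apply: measurableT_comp; [exact: measurable_sqrtr|exact: measurable_L2].
have base k : {ae leb01 R, forall t, [/\ ppart (v k) t = (v k t)%:E,
    delta_pos delta t = delta t &
    kernel_op b (fun s => (e (k - 1) s * Num.sqrt (v (k - 1) s)) ^+ 2) t =
    arch_op b (fun s => L2_eval (e (k - 1), s)) (ppart (v (k - 1))) t]}.
  by apply: ae01S3 (ppartE (v0 k)) ae_delta_pos (kE k) => t; split.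
split=> [vE|[_ vE] k]; last by apply: ae01S2 (vE k) (base k) => t + [<- <- ->].
by split=> // k; apply: ae01S2 (vE k) (base k) => t + [-> -> <-].
Qed.

Lemma path_sol_ge_vol v k : path_sol v ->
  {ae leb01 R, forall t, (vol_lim b delta (past k) t <= ppart (v k) t)%E}.
Proof.
move=> [v0 vE].
have := @vol_lim_le R b mb delta (past k) (fun j => ppart (v (k - j%:Z))).
rewrite subr0; apply.
- by move=> j; exact: measurable_ppart.
- by move=> j t; exact: ppart_ge0.
move=> j; have := vE (k - j%:Z); rewrite /past.
have -> : k - j%:Z - 1 = k - 1 - j%:Z by lia.
by have -> : k - j.+1%:Z = k - 1 - j%:Z by lia.
Qed.

Variable kappa : int -> R.
Hypothesis kappa_ge0 : forall k, 0 <= kappa k.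
Hypothesis kappaP : forall k, (sqK b (fun s => L2_eval (e k, s)) <= (kappa k ^+ 2)%:E)%E.

Definition path_diff (v v' : int -> L2 R) k t : \bar R := (`|v' k t - v k t|)%:E.

Lemma measurable_path_diff v v' k : measurable_fun setT (path_diff v v' k).
Proof.
apply/measurable_EFinP; apply: measurableT_comp => //.
by apply: measurable_funB; exact: measurable_L2.
Qed.

(** As [v <= v'], the two affine equations can be subtracted without leaving the non-negative
    functions: [delta] cancels, and the difference at [k] is the operator applied to the difference
    at [k - 1]. *)
Lemma path_diff_contract v v' k : path_sol v -> path_sol v' ->
  (forall j, {ae leb01 R, forall t, (ppart (v j) t <= ppart (v' j) t)%E}) ->
  (sqnorm (path_diff v v' k) <=
   (kappa (k - 1)%R ^+ 2)%:E * sqnorm (path_diff v v' (k - 1)%R))%E.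
Proof.
move=> [v0 vE] [v'0 v'E] vv'.
have dE j : {ae leb01 R, forall t, ppart (v' j) t = (ppart (v j) t + path_diff v v' j t)%E}.
  apply: ae01S3 (vv' j) (v0 j) (v'0 j) => t; rewrite /ppart /path_diff lee_fin => + h1 h2.
  rewrite !max_l// => h3; rewrite -EFinD ger0_norm ?subr_ge0//; congr EFin; ring.
have key : {ae leb01 R, forall t, path_diff v v' k t =
    arch_op b (fun s => L2_eval (e (k - 1), s)) (path_diff v v' (k - 1)) t}.
  apply: ae01S3 (vE k) (v'E k) (dE k) => t h1 h2 h3.
  move: h2; rewrite h3 {h3}.
  have -> : arch_op b (fun s => L2_eval (e (k - 1), s)) (ppart (v' (k - 1))) t =
     (arch_op b (fun s => L2_eval (e (k - 1)%R, s)) (ppart (v (k - 1)%R)) t +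
      arch_op b (fun s => L2_eval (e (k - 1)%R, s)) (path_diff v v' (k - 1)%R) t)%E.
    have mk : measurable_fun setT (fun s => (pos_kernel b t s * L2_eval (e (k - 1), s) ^+ 2)%:E).
      apply/measurable_EFinP/measurable_funM; last first.
        by apply: measurable_funX; exact: measurable_eval.
      by apply: measurable_maxr; [exact: measurable_kernel_section|exact: measurable_cst].
    have k0 s : (0 <= (pos_kernel b t s * L2_eval (e (k - 1), s) ^+ 2)%:E)%E.
      by rewrite lee_fin mulr_ge0 ?pos_kernel_ge0 ?sqr_ge0.
    rewrite /arch_op -ge0_integralD//.
    - apply: ae01_eq_integral.
      + by apply: emeasurable_funM => //; exact: measurable_ppart.
      + apply: emeasurable_funD; apply: emeasurable_funM => //.
          exact: measurable_ppart.
        exact: measurable_path_diff.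
      + apply: ae01S (dE (k - 1)) => s ->.
        by rewrite ge0_muleDr ?ppart_ge0// /path_diff lee_fin.
    - by move=> s _; rewrite mule_ge0 ?ppart_ge0.
    - by apply: emeasurable_funM => //; exact: measurable_ppart.
    - by move=> s _; rewrite mule_ge0// /path_diff lee_fin.
    - by apply: emeasurable_funM => //; exact: measurable_path_diff.
  (* The subtraction is legitimate since [ppart (v k) t] is finite. *)
  rewrite addeA -h1 => /(congr1 (fun z => z - ppart (v k) t)%E).
  by rewrite [X in X = _ -> _]addeAC subee// add0e [X in _ = X -> _]addeAC subee// add0e.
rewrite /sqnorm (@ae01_eq_integral _ _ (fun t =>
   arch_op b (fun s => L2_eval (e (k - 1)%R, s)) (path_diff v v' (k - 1)%R) t *
   arch_op b (fun s => L2_eval (e (k - 1)%R, s)) (path_diff v v' (k - 1)%R) t)%E).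
- apply: le_trans (arch_op_bound mb _ _ _) _.
  + exact: measurable_eval.
  + exact: measurable_path_diff.
  + by move=> s; rewrite lee_fin.
  apply: lee_wpmul2r; last exact: kappaP.
  by apply: integral_ge0 => t _; rewrite mule_ge0// lee_fin.
- by apply: emeasurable_funM; exact: measurable_path_diff.
- have mop : measurable_fun setT
      (arch_op b (fun s => L2_eval (e (k - 1), s)) (path_diff v v' (k - 1))).
    apply: measurable_arch_op => //.
    + exact: measurable_eval.
    + exact: measurable_path_diff.
    + by move=> s; rewrite lee_fin.
  exact: emeasurable_funM.
- by apply: ae01S key => t ->.
Qed.

(** After [n] contractions, [0 <= v' - v <= v'] replaces the difference by [v'] itself, so that only
    the size of [v'] has to be controlled. *)
Lemma path_diff_iter v v' k n : path_sol v -> path_sol v' ->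
  (forall j, {ae leb01 R, forall t, (ppart (v j) t <= ppart (v' j) t)%E}) ->
  (sqnorm (path_diff v v' k) <=
   ((\prod_(i < n) kappa (k - 1 - i%:Z)) ^+ 2)%:E * sqint (v' (k - n%:Z)%R))%E.
Proof.
move=> sv sv' vv'.
have h : (sqnorm (path_diff v v' k) <=
   ((\prod_(i < n) kappa (k - 1 - i%:Z)) ^+ 2)%:E * sqnorm (path_diff v v' (k - n%:Z)%R))%E.
  elim: n => [|n IH]; first by rewrite big_ord0 expr1n mul1e subr0.
  apply: le_trans IH _; rewrite big_ord_recr/= exprMn.
  rewrite [X in (_ <= X%:E * _)%E]mulrC [X in (_ <= X * _)%E]EFinM muleC.
  rewrite [leRHS]muleAC [leRHS]muleC [leLHS]muleC.
  apply: lee_wpmul2l; first by rewrite lee_fin sqr_ge0.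
  have := path_diff_contract (k - n%:Z) sv sv' vv'.
  have -> : k - n%:Z - 1 = k - 1 - n%:Z by lia.
  by have -> : k - n.+1%:Z = k - 1 - n%:Z by lia.
apply: le_trans h _; apply: lee_wpmul2l; first by rewrite lee_fin sqr_ge0.
apply: ae_ge0_le_integral => //.
- by move=> t _; rewrite mule_ge0// lee_fin.
- by apply: emeasurable_funM; exact: measurable_path_diff.
- by move=> t _; rewrite lee_fin sqr_ge0.
- by apply/measurable_EFinP/measurable_funX; exact: measurable_L2.
apply: ae01S3 (vv' (k - n%:Z)) (sv.1 (k - n%:Z)) (sv'.1 (k - n%:Z)) => t + h1 h2 _.
rewrite /path_diff /ppart lee_fin !max_l// => h3.
rewrite -EFinM lee_fin ger0_norm ?subr_ge0// -expr2 ler_sqr ?nnegrE ?subr_ge0//.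
by rewrite gerBl.
Qed.

Hypothesis geom : forall k, exists C q : R, [/\ 0 <= C, 0 <= q, q < 1 &
  forall n, \prod_(i < n) kappa (k - 1 - i%:Z) <= C * q ^+ n].

Definition path_vol (k : int) : L2 R := mkL2 (fun t => fine (vol_lim b delta (past k) t)).

Lemma vol_lim_past_lty k : (sqnorm (vol_lim b delta (past k)) < +oo)%E.
Proof.
have [C [q [C0 q0 q1 hq]]] := geom k.
have dfin : (sqnorm (EFin \o delta_pos delta) < +oo)%E.
  rewrite /sqnorm (@ae01_eq_integral _ _ (fun t => (delta t ^+ 2)%:E)).
  - exact: finite_L2.
  - by apply: emeasurable_funM; apply/measurable_EFinP; exact: measurable_delta_pos.
  - by apply/measurable_EFinP/measurable_funX; exact: measurable_L2.
  - by apply: ae01S ae_delta_pos => t /= ->; rewrite -EFinM.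
have d0 : (0 <= sqnorm (EFin \o delta_pos delta))%E.
  by apply: integral_ge0 => t _; rewrite mule_ge0// lee_fin delta_pos_ge0.
pose A := Num.sqrt (fine (sqnorm (EFin \o delta_pos delta))).
have A0 : 0 <= A by exact: sqrtr_ge0.
have hA : (sqnorm (EFin \o delta_pos delta) <= (A ^+ 2)%:E)%E.
  by rewrite sqr_sqrtr ?fine_ge0// fineK// ge0_fin_numE.
(* The norm of [delta] times the sum of the geometric series that dominates the products of
   [kappa]. *)
pose B := (A * (C / (1 - q))) ^+ 2.
apply: (@le_lt_trans _ _ B%:E); last exact: ltry.
apply: vol_lim_sqnorm => // n.
apply: le_trans (vol_bound mb n (f := past k) (kappa := fun i => kappa (k - 1 - i%:Z)) A0 hA _ _) _.
- by move=> j; exact: kappa_ge0.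
- by move=> j; exact: kappaP.
have s0 : 0 <= \sum_(m < n) \prod_(i < m) kappa (k - 1 - i%:Z).
  by rewrite sumr_ge0// => m _; rewrite prodr_ge0.
rewrite lee_fin lerXn2r ?nnegrE ?mulr_ge0 ?invr_ge0 ?subr_ge0 ?(ltW q1)// ler_wpM2l//.
apply: (@le_trans _ _ (\sum_(m < n) C * q ^+ m)); first exact: ler_sum.
rewrite -mulr_sumr ler_wpM2l// -[leRHS]mul1r ler_pdivlMr ?subr_gt0//.
have := subrX1 q n; have := exprn_ge0 n q0.
move: (\sum_(i < n) q ^+ i) => S; nra.
Qed.

Lemma path_volE k : {ae leb01 R, forall t, (path_vol k t)%:E = vol_lim b delta (past k) t}.
Proof.
have h := vol_lim_past_lty k.
have mv := measurable_vol_lim_section mb delta (past k).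
have v0 := vol_lim_ge0 mb delta (past k).
have mf : measurable_fun setT (fun t => fine (vol_lim b delta (past k) t)).
  exact: measurableT_comp.
have fin : (sqint (fun t => fine (vol_lim b delta (past k) t)) < +oo)%E.
  apply: le_lt_trans h; apply: ge0_le_integral => //.
  - by move=> t _; rewrite lee_fin sqr_ge0.
  - exact/measurable_EFinP/measurable_funX.
  - exact: emeasurable_funM.
  - move=> t _; have := v0 t; case: (vol_lim _ _ _ _) => [r| |]//= _.
    by rewrite expr0n mulyy leey.
(* [fine] sends [+oo] to 0, which the bound [fin] tolerates; finiteness almost everywhere now shows
   that nothing was lost. *)
have ae_fin : {ae leb01 R, forall t, (vol_lim b delta (past k) t * vol_lim b delta (past k) t < +oo)%E}.
  apply: ae_lty => //; first exact: emeasurable_funM.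
  by move=> t; rewrite mule_ge0.
apply: ae01S2 (mkL2E mf fin) ae_fin => t -> ht.
by rewrite fineK//; have := v0 t; move: ht; case: (vol_lim _ _ _ _).
Qed.

Lemma path_vol_sol : path_sol path_vol.
Proof.
have n0 k : L2_nonneg (path_vol k).
  apply: ae01S (path_volE k) => t h; rewrite -lee_fin h; exact: vol_lim_ge0.
split=> // k.
apply: ae01S2 (path_volE k) (ppartE (n0 k)) => t h1 ->.
rewrite h1 vol_lim_eq// past0 shiftf_past; congr (_ + _)%E.
rewrite /arch_op; apply: ae01_eq_integral.
- apply: emeasurable_funM; last exact: measurable_vol_lim_section.
  apply/measurable_EFinP/measurable_funM; last first.
    by apply: measurable_funX; exact: measurable_eval.
  by apply: measurable_maxr; [exact: measurable_kernel_section|exact: measurable_cst].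
- apply: emeasurable_funM; last exact: measurable_ppart.
  apply/measurable_EFinP/measurable_funM; last first.
    by apply: measurable_funX; exact: measurable_eval.
  by apply: measurable_maxr; [exact: measurable_kernel_section|exact: measurable_cst].
- by apply: ae01S2 (path_volE (k - 1)) (ppartE (n0 (k - 1))) => s <- ->.
Qed.

Lemma path_vol_le v k : path_sol v ->
  {ae leb01 R, forall t, (ppart (path_vol k) t <= ppart (v k) t)%E}.
Proof.
move=> sv; apply: ae01S3 (path_volE k) (ppartE (path_vol_sol.1 k)) (path_sol_ge_vol k sv).
by move=> t <- ->.
Qed.

Lemma path_unique_bound v k n : path_sol v ->
  (\int[leb01 R]_t ((v k t - path_vol k t) ^+ 2)%:E <=
   ((\prod_(i < n) kappa (k - 1 - i%:Z)) ^+ 2)%:E * sqint (v (k - n%:Z)%R))%E.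
Proof.
move=> sv; have := path_diff_iter k n path_vol_sol sv (fun j => path_vol_le j sv).
apply: le_trans; rewrite le_eqVlt; apply/orP; left; apply/eqP.
by apply: eq_integral => t _; rewrite /path_diff -EFinM -expr2 real_normK ?num_real.
Qed.

End path.

(** * Vanishing in probability *)

Section prob.
Context (R : realType) (d : measure_display) (T : measurableType d)
  (P : probability T R).

Lemma ae_forall_int (Q : int -> T -> Prop) :
  (forall k, {ae P, forall w, Q k w}) -> {ae P, forall w, forall k, Q k w}.
Proof.
move=> h.
have h1 : {ae P, forall w, forall n : nat, Q n%:Z w} by apply: ae_foralln.
have h2 : {ae P, forall w, forall n : nat, Q (- n%:Z) w} by apply: ae_foralln.
apply: filterS2 h1 h2 => w w1 w2 [n|n]; first exact: w1.
by rewrite NegzE; exact: w2.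
Qed.

Lemma probability_ae_eq (A B : set T) : measurable A -> measurable B ->
  {ae P, forall w, A w <-> B w} -> P A = P B.
Proof.
move=> mA mB AB.
have := integral_indic P measurableT mA; have := integral_indic P measurableT mB.
rewrite !setIT => <- <-; apply: ae_eq_integral => //.
- by apply/measurable_EFinP; exact: measurable_indic.
- by apply/measurable_EFinP; exact: measurable_indic.
apply: filterS AB => w AB _; rewrite !indicE; congr (_%:R%:E)%R.
by congr nat_of_bool; apply/idP/idP; rewrite !inE => /AB.
Qed.

(** The events [m <= N] decrease to the empty set. This treats a single variable; equality of laws
    then makes [M] uniform in time. *)
Lemma tight_lty (N : T -> \bar R) (eta : R) : measurable_fun setT N ->
  (forall w, N w < +oo)%E -> 0 < eta ->
  exists2 M : R, 0 < M & (P [set w | (M%:E <= N w)%E] < eta%:E)%E.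
Proof.
move=> mN Nfin eta0.
pose F (m : nat) := [set w | (m%:R%:E <= N w)%E].
have mF m : measurable (F m).
  by rewrite -[X in measurable X]setTI; exact: emeasurable_fun_c_infty.
have F0 : \bigcap_m F m = set0.
  apply/seteqP; split => // w Fw; have := Nfin w.
  case E : (N w) => [r| |] // _; last by have := Fw 0%N I; rewrite /F/= E.
  have [m hm] : exists m : nat, r < m%:R.
    by exists (Num.truncn `|r|).+1; apply: le_lt_trans (ler_norm r) _; exact: truncnS_gt.
  by have := Fw m I; rewrite /F/= E lee_fin leNgt hm.
have ndF : nonincreasing_seq F.
  move=> m n mn; apply/subsetPset => w; rewrite /F/=; apply: le_trans.
  by rewrite lee_fin ler_nat.
have /cvge_near_lt : (P \o F) m @[m --> \oo] --> P (\bigcap_m F m).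
  apply: nonincreasing_cvg_mu => //.
  - by apply: (le_lt_trans (probability_le1 P (mF 0%N))); exact: ltry.
  - by apply: bigcap_measurableType => m _.
rewrite F0 measure0 => /(_ eta%:E eta0)[m hm].
exists m.+1%:R; first by rewrite ltr0n.
apply: le_lt_trans hm; apply: le_measure; rewrite ?inE//; first exact: (mF m.+1).
by apply/subsetPset; exact: ndF.
Qed.

(** If [D >= r], then [a n >= r / M] or [N n >= M], up to a null set. Choose [M] by tightness, then
    [n]; as [D] does not depend on [n], the event [D >= r] is null. *)
Lemma vanish_in_probability (D : T -> \bar R) (a : nat -> T -> R) (N : nat -> T -> \bar R) :
  measurable_fun setT D -> (forall n, measurable_fun setT (a n)) ->
  (forall n, measurable_fun setT (N n)) ->
  (forall w, 0 <= D w)%E -> (forall n w, 0 <= a n w) -> (forall n w, 0 <= N n w)%E ->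
  (forall n, {ae P, forall w, (D w <= (a n w)%:E * N n w)%E}) ->
  (forall r eta : R, 0 < r -> 0 < eta -> exists n, (P [set w | (r <= a n w)%R] <= eta%:E)%E) ->
  (forall eta : R, 0 < eta ->
     exists2 M : R, 0 < M & forall n, (P [set w | (M%:E <= N n w)%E] <= eta%:E)%E) ->
  {ae P, forall w, D w = 0%E}.
Proof.
move=> mD ma mN D0 a0 N0 Dle asmall Ntight.
have mDr (r : R) : measurable [set w | (r%:E <= D w)%E].
  by rewrite -[X in measurable X]setTI; exact: emeasurable_fun_c_infty.
have key (r : R) : 0 < r -> P [set w | (r%:E <= D w)%E] = 0%E.
  move=> r0; apply/eqP; rewrite eq_le measure_ge0 andbT.
  apply/lee_addgt0Pr => eta eta0; rewrite add0e.
  have eta2 : 0 < eta / 2 by rewrite divr_gt0.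
  have [M M0 hM] := Ntight _ eta2.
  have rM : 0 < r / M by rewrite divr_gt0.
  have [n hn] := asmall _ _ rM eta2.
  have mA : measurable [set w | r / M <= a n w].
    rewrite (_ : [set w | _] = a n @^-1` `[r / M, +oo[%classic).
      by rewrite -[X in measurable X]setTI; exact: ma.
    by apply/seteqP; split => w /=; rewrite in_itv/= andbT.
  have mB : measurable [set w | (M%:E <= N n w)%E].
    by rewrite -[X in measurable X]setTI; exact: emeasurable_fun_c_infty.
  have [Z [mZ Z0 hZ]] := Dle n.
  apply: (@le_trans _ _ (P ([set w | (r / M <= a n w)%R] `|` [set w | (M%:E <= N n w)%E] `|` Z))).
    apply: le_measure; rewrite ?inE//.
      by apply: measurableU => //; exact: measurableU.
    move=> w /= rD; have [|Zw] := pselect (Z w); first by right.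
    left; apply/not_notP => /not_orP[/negP + /negP].
    rewrite -!ltNge => h1 h2.
    have hD : (D w <= (a n w)%:E * N n w)%E.
      by apply: contrapT => h; apply: Zw; exact: hZ.
    have : (r%:E < r%:E)%E; last by rewrite ltxx.
    apply: (le_lt_trans rD); apply: (le_lt_trans hD).
    apply: (@le_lt_trans _ _ ((a n w)%:E * M%:E)%E).
      by apply: lee_wpmul2l; [rewrite lee_fin|exact: ltW].
    by rewrite -EFinM lte_fin -ltr_pdivlMr.
  apply: le_trans (measureU2 _ _ _) _ => //; first exact: measurableU.
  rewrite [X in (_ + X)%E]Z0 adde0.
  apply: le_trans (measureU2 _ _ _) _ => //.
  by rewrite [eta]splitr EFinD; apply: leeD => //; exact: hM.
apply: (@negligibleS _ _ _ P (\bigcup_n [set w | ((n.+1%:R^-1)%:E <= D w)%E])); last first.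
  apply: negligible_bigcup => n; apply/negligibleP => //.
  by apply: key; rewrite invr_gt0 ltr0n.
move=> w /= Dw.
have [r r0 rD] : exists2 r : R, 0 < r & (r%:E <= D w)%E.
  move: (D0 w) Dw; case: (D w) => [x| |]//; last by exists 1; rewrite ?leey.
  rewrite lee_fin => x0 xn; exists x => //.
  by rewrite lt_neqAle x0 andbT; apply/eqP => h; apply: xn; rewrite -h.
have [N' _ /(_ N' (leqnn _)) hN] := near_infty_natSinv_lt (PosNum r0).
exists N' => //=; apply: le_trans rD; rewrite lee_fin; exact: ltW.
Qed.

End prob.

(** * Decay of products of i.i.d. factors *)

Section geometric.
Context (R : realType) (d d' : measure_display) (T : measurableType d)
  (X : measurableType d') (P : probability T R) (e : int -> T -> X).
Hypothesis e_iid : iid P e.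
Variables (kappa : X -> R) (alpha rho : R).
Hypothesis mkappa : measurable_fun setT kappa.
Hypothesis kappa0 : forall x, 0 <= kappa x.
Hypothesis alpha0 : 0 < alpha.
Hypothesis rhoE : (\int[P]_w (kappa (e 0 w) `^ alpha)%:E = rho%:E)%E.
Hypothesis rho1 : rho < 1.

Let mkp : measurable_fun setT (fun x => kappa x `^ alpha).
Proof. exact: (measurableT_comp (measurable_powR alpha) mkappa). Qed.

Let rho0 : 0 <= rho.
Proof. by rewrite -lee_fin -rhoE; apply: integral_ge0 => w _; rewrite lee_fin powR_ge0. Qed.

Lemma powR_prod (I : Type) (s : seq I) (f : I -> R) : (forall i, 0 <= f i) ->
  (\prod_(i <- s) f i) `^ alpha = \prod_(i <- s) (f i `^ alpha).
Proof.
move=> f0; elim: s => [|i s IH]; first by rewrite !big_nil powR1.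
by rewrite !big_cons powRM ?IH// prodr_ge0.
Qed.

Definition kprod k n w := \prod_(i < n) kappa (e (k - 1 - i%:Z) w).

Lemma kprod_ge0 k n w : 0 <= kprod k n w.
Proof. by apply: prodr_ge0. Qed.

Lemma measurable_kprod k n : measurable_fun setT (kprod k n).
Proof.
apply: measurable_prod => i _; apply: measurableT_comp => //.
exact: (iid_measurable e_iid).
Qed.

Lemma kprod_moment k n :
  (\int[P]_w (kprod k n w `^ alpha)%:E = (rho ^+ n)%:E)%E.
Proof.
pose J := [seq (k : int) - 1 - i%:Z | i <- iota 0 n].
have uJ : uniq J.
  by rewrite map_inj_uniq ?iota_uniq// => i j /addrI/oppr_inj [].
have sJ : size J = n by rewrite size_map size_iota.
rewrite -[in RHS]sJ -(iid_integral_prod e_iid mkp _ rhoE uJ); last first.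
  by move=> x; exact: powR_ge0.
apply: eq_integral => w _; rewrite /kprod powR_prod//.
rewrite big_map (_ : iota 0 n = index_iota 0 n); last by rewrite /index_iota subn0.
by rewrite big_mkord.
Qed.

(** Markov's inequality for the moment [rho ^+ n]. The threshold is [r] to the power [alpha / 2]
    because [r] bounds the square of the product. *)
Lemma kprod_small k (r eta : R) : 0 < r -> 0 < eta ->
  exists n, (P [set w | (r <= kprod k n w ^+ 2)%R] <= eta%:E)%E.
Proof.
move=> r0 eta0.
have r2 : 0 < r `^ (alpha / 2) by exact: powR_gt0.
have mg n : measurable_fun setT (fun w => (kprod k n w `^ alpha)%:E).
  apply/measurable_EFinP.
  exact: (measurableT_comp (measurable_powR alpha) (measurable_kprod k n)).
have [n hn] : exists n, rho ^+ n < eta * r `^ (alpha / 2).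
  have h : 0 < eta * r `^ (alpha / 2) by rewrite mulr_gt0.
  have : rho ^+ n @[n --> \oo] --> (0 : R) by apply: cvg_expr; rewrite ger0_norm.
  by move=> /cvgr_lt /(_ _ h)[n _ /(_ n (leqnn n))]; exists n.
exists n.
have := @le_integral_abse _ _ _ P setT measurableT _ _ (mg n) r2.
rewrite setTI; under [X in (_ <= X)%E -> _]eq_integral do rewrite gee0_abs ?lee_fin ?powR_ge0//.
rewrite kprod_moment => h.
rewrite -(@lee_pmul2l _ (r `^ (alpha / 2))%:E)//.
apply: (@le_trans _ _ (rho ^+ n)%:E); last by rewrite -EFinM lee_fin mulrC ltW.
apply: le_trans h; apply: lee_wpmul2l; first by rewrite lee_fin ltW.
apply: le_measure; rewrite ?inE.
- rewrite (_ : [set w | _] = (fun w => kprod k n w ^+ 2) @^-1` `[r, +oo[%classic).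
    rewrite -[X in measurable X]setTI; apply: measurable_funX => //.
    exact: measurable_kprod.
  by apply/seteqP; split => w /=; rewrite in_itv/= andbT.
- rewrite -[X in measurable X]setTI; apply: emeasurable_fun_c_infty => //.
  exact: measurableT_comp.
- move=> w /= h; rewrite lee_fin ger0_norm ?powR_ge0//.
  have -> : kprod k n w `^ alpha = (kprod k n w ^+ 2) `^ (alpha / 2).
    by rewrite -powR_mulrn ?kprod_ge0// -powRrM; congr (_ `^ _); field.
  apply: ge0_ler_powR => //; rewrite ?nnegrE ?sqr_ge0 ?ltW//.
  by rewrite divr_gt0.
Qed.

(** For [rho < r < 1] the series of [r^-n kprod^alpha] has mean the sum of [(rho / r)^n], so it is
    almost surely finite and bounds each of its terms. Roots of order [alpha] give [C] and [q]. *)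
Lemma kprod_geometric k : {ae P, forall w, exists C q : R, [/\ 0 <= C, 0 <= q, q < 1 &
  forall n, kprod k n w <= C * q ^+ n]}.
Proof.
have [r [r0 r1 rr]] : exists r : R, [/\ 0 < r, r < 1 & rho < r].
  by exists ((rho + 1) / 2); split; move: rho0 rho1; lra.
have ri0 : 0 < r^-1 by rewrite invr_gt0.
pose f n w := ((r^-1 ^+ n) * kprod k n w `^ alpha)%:E.
have f0 n w : (0 <= f n w)%E by rewrite lee_fin mulr_ge0 ?powR_ge0// exprn_ge0// ltW.
have mp n : measurable_fun setT (fun w => kprod k n w `^ alpha).
  exact: (measurableT_comp (measurable_powR alpha) (measurable_kprod k n)).
have mf n : measurable_fun setT (f n).
  by apply/measurable_EFinP; apply: measurable_funM => //; exact: measurable_cst.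
have fi n : (\int[P]_w f n w = ((rho / r) ^+ n)%:E)%E.
  rewrite /f; under eq_integral do rewrite EFinM.
  rewrite ge0_integralZl//; last 3 first.
  - exact/measurable_EFinP.
  - by move=> w _; rewrite lee_fin powR_ge0.
  - by rewrite lee_fin exprn_ge0// ltW.
  by rewrite kprod_moment -EFinM exprMn mulrC.
have h : {ae P, forall w, (\sum_(n <oo) f n w < +oo)%E}.
  apply: ae_lty.
  - by apply: ge0_emeasurable_sum => [n w _ _|n _]; [exact: f0|exact: mf].
  - by move=> w; apply: nneseries_ge0.
  rewrite integral_nneseries//.
  have q1 : `|rho / r| < 1.
    rewrite ger0_norm; last by rewrite divr_ge0// ltW.
    by rewrite ltr_pdivrMr// mul1r.
  have hs := @cvg_geometric_series R 1 _ q1.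
  rewrite (_ : (\sum_(n <oo) _)%E = (1 / (1 - rho / r))%:E) ?ltry//.
  apply/cvg_lim => //.
  rewrite (_ : (fun n => _) = EFin \o series (geometric 1 (rho / r))).
    by apply: cvg_EFin => //; exact: nearW.
  apply/funext => n /=; rewrite /series/= -sumEFin.
  by apply: eq_bigr => i _; rewrite fi mul1r.
apply: filterS h => w hw.
pose C := fine (\sum_(n <oo) f n w)%E.
have S0 : (0 <= \sum_(n <oo) f n w)%E by apply: nneseries_ge0.
have C0 : 0 <= C by rewrite fine_ge0.
have fC n : r^-1 ^+ n * kprod k n w `^ alpha <= C.
  rewrite -lee_fin fineK ?ge0_fin_numE//.
  apply: (@le_trans _ _ (\sum_(0 <= i < n.+1) f i w)%E); last first.
    exact: nneseries_lim_ge.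
  by rewrite big_nat_recr//= leeDr// sume_ge0.
exists (C `^ alpha^-1), (r `^ alpha^-1); split.
- exact: powR_ge0.
- exact: powR_ge0.
- have := @gt0_ltr_powR R alpha^-1; rewrite invr_gt0 => /(_ alpha0 r 1).
  by rewrite powR1 !nnegrE => ->//; exact: ltW.
move=> n.
have -> : kprod k n w = (kprod k n w `^ alpha) `^ alpha^-1.
  by rewrite -powRrM divff ?gt_eqF// powRr1// kprod_ge0.
have -> : (r `^ alpha^-1) ^+ n = (r ^+ n) `^ alpha^-1.
  have rn : 0 <= r := ltW r0.
  by rewrite -(powR_mulrn n rn) -(powR_mulrn n (powR_ge0 r alpha^-1)) powRAC.
rewrite -powRM ?exprn_ge0 ?(ltW r0)//.
apply: ge0_ler_powR; rewrite ?nnegrE ?powR_ge0 ?invr_ge0 ?(ltW alpha0)//.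
  by rewrite mulr_ge0// exprn_ge0// ltW.
by have := fC n; rewrite exprVn mulrC ler_pdivrMr ?exprn_gt0.
Qed.

End geometric.

(** * Stationary solutions *)

Lemma measurable_sqint_L2 (R : realType) : measurable_fun setT (fun x : L2 R => sqint x).
Proof.
rewrite (_ : (fun x : L2 R => sqint x) = fun x : L2 R => sqint (fun t => L2_eval (x, t))).
  exact: (@measurable_sqint R _ (L2 R) (@L2_eval R) (@measurable_L2_eval R)).
apply/funext => x; apply: ae01_eq_integral.
- by apply/measurable_EFinP/measurable_funX; exact: measurable_L2.
- by apply/measurable_EFinP/measurable_funX; exact: measurable_eval.
- by apply: ae01S (L2_evalE x) => t ->.
Qed.

Section arch_K.
Variables (R : realType) (b : R -> R -> R).
Hypothesis mb : measurable_fun setT (fun ts : measurableTypeR R * measurableTypeR R =>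
                         b ts.1 ts.2 : measurableTypeR R).

Lemma arch_KE (x : L2 R) :
  arch_K b x = (sqK b (fun s => L2_eval (x, s)) `^ 2^-1)%E.
Proof.
rewrite /arch_K /sqK.
rewrite (@eq_integral _ _ _ (leb01 R) setT
  (fun t => \int[leb01 R]_s (b t s ^+ 2 * L2_eval (x, s) ^+ 4)%:E)%E)//= => t _.
have mbt := measurable_kernel_section mb t.
apply: ae01_eq_integral.
- apply/measurable_EFinP/measurable_funM; apply: measurable_funX => //.
  exact: measurable_L2.
- apply/measurable_EFinP/measurable_funM; apply: measurable_funX => //.
  exact: measurable_eval.
- by apply: ae01S (L2_evalE x) => s ->.
Qed.

Lemma measurable_sqK :
  measurable_fun setT (fun x : L2 R => sqK b (fun s => L2_eval (x, s))).
Proof.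
have h0 (z : (L2 R * measurableTypeR R) * measurableTypeR R) :
    (0 <= (b z.1.2 z.2 ^+ 2 * L2_eval (z.1.1, z.2) ^+ 4)%:E)%E.
  by rewrite lee_fin mulr_ge0 ?sqr_ge0// (exprM _ 2 2) sqr_ge0.
apply: (@measurable_integral01 R _ (L2 R) (fun xt =>
  \int[leb01 R]_s (b xt.2 s ^+ 2 * L2_eval (xt.1, s) ^+ 4)%:E)%E); last first.
  by move=> xt; apply: integral_ge0 => s _; exact: (h0 (xt, s)).
apply: (@measurable_integral01 R _ _ (fun z : (L2 R * measurableTypeR R) * measurableTypeR R =>
  (b z.1.2 z.2 ^+ 2 * L2_eval (z.1.1, z.2) ^+ 4)%:E)) => //.
apply/measurable_EFinP/measurable_funM; apply: measurable_funX.
  have m1 : measurable_fun setT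
      (fun z : (L2 R * measurableTypeR R) * measurableTypeR R => (z.1.2, z.2)).
    by apply: measurable_fun_pair => //; exact: measurableT_comp.
  exact: (measurableT_comp mb m1).
have m2 : measurable_fun setT
    (fun z : (L2 R * measurableTypeR R) * measurableTypeR R => (z.1.1, z.2)).
  by apply: measurable_fun_pair => //; exact: measurableT_comp.
exact: (measurableT_comp (@measurable_L2_eval R) m2).
Qed.

Lemma measurable_arch_K : measurable_fun setT (fun x : L2 R => arch_K b x).
Proof.
rewrite (_ : (fun x : L2 R => arch_K b x) =
  fun x => (sqK b (fun s => L2_eval (x, s)) `^ 2^-1)%E); last first.
  by apply/funext => x; exact: arch_KE.
exact: (measurableT_comp (measurable_poweR _) measurable_sqK).
Qed.

Lemma sqK_arch_K (x : L2 R) : (arch_K b x < +oo)%E ->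
  (sqK b (fun s => L2_eval (x, s)) <= (fine (arch_K b x) ^+ 2)%:E)%E.
Proof.
rewrite arch_KE.
have : (0 <= sqK b (fun s => L2_eval (x, s)))%E.
  apply: integral_ge0 => t _; apply: integral_ge0 => s _.
  by rewrite lee_fin mulr_ge0 ?sqr_ge0// (exprM _ 2 2) sqr_ge0.
case: (sqK _ _) => [r| |]//; last by rewrite poweRyr ?invr_neq0.
by rewrite lee_fin => r0 _; rewrite poweR_EFin/= powR12_sqrt// sqr_sqrtr.
Qed.

End arch_K.

(** * The volatility process: existence and uniqueness *)

Section arch_process.
Context (R : realType) (d : measure_display) (T : measurableType d)
  (P : probability T R) (eps : int -> T -> L2 R) (delta : L2 R)
  (b : R -> R -> R) (alpha : R).
Hypothesis eps_iid : iid P eps.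
Hypothesis delta_ge0 : L2_nonneg delta.
Hypothesis b_ge0 : nonneg_kernel_op b.
Hypothesis b_bounded : bounded_kernel_op b.
Hypothesis alpha_gt0 : 0 < alpha.
Hypothesis K_moment : (\int[P]_w (arch_K b (eps 1%R w) `^ alpha) < 1)%E.
Let mb := b_bounded.1.

(** An infinite [K] becomes 0; [arch_K_lty] makes this an event of probability 0. *)
Definition arch_kappa (x : L2 R) : R := fine (arch_K b x).

Lemma arch_kappa_ge0 x : 0 <= arch_kappa x.
Proof. by rewrite /arch_kappa fine_ge0// poweR_ge0. Qed.

Lemma measurable_arch_kappa : measurable_fun setT arch_kappa.
Proof. exact: (measurableT_comp _ (measurable_arch_K mb)). Qed.

Let mKa : measurable_fun setT (fun x : L2 R => arch_K b x `^ alpha)%E.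
Proof. exact: (measurableT_comp (measurable_poweR alpha) (measurable_arch_K mb)). Qed.

Let K_moment_k k : (\int[P]_w (arch_K b (eps k w) `^ alpha) < 1)%E.
Proof.
have K0 (x : L2 R) : (0 <= arch_K b x `^ alpha)%E by exact: poweR_ge0.
have E j := iid_integral eps_iid j mKa K0.
have e1k := etrans (E k) (esym (E 1)).
exact: (eq_ind_r (fun z => (z < 1)%E) K_moment e1k).
Qed.

Lemma arch_K_lty k : {ae P, forall w, (arch_K b (eps k w) < +oo)%E}.
Proof.
have h : {ae P, forall w, (arch_K b (eps k w) `^ alpha < +oo)%E}.
  apply: ae_lty.
  - exact: (measurableT_comp mKa (iid_measurable eps_iid k)).
  - by move=> w; exact: poweR_ge0.
  - exact: lt_trans (K_moment_k k) (ltry 1).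
apply: filterS h => w; apply: lty_poweRy; exact: lt0r_neq0.
Qed.

Lemma arch_kappa_moment : exists2 rho : R, rho < 1 &
  (\int[P]_w (arch_kappa (eps 0 w) `^ alpha)%:E = rho%:E)%E.
Proof.
have mkp : measurable_fun setT (fun w => (arch_kappa (eps 0 w) `^ alpha)%:E).
  apply/measurable_EFinP; apply: (measurableT_comp (measurable_powR alpha)).
  exact: (measurableT_comp measurable_arch_kappa (iid_measurable eps_iid 0)).
have lt1 : (\int[P]_w (arch_kappa (eps 0 w) `^ alpha)%:E < 1)%E.
  apply: le_lt_trans (K_moment_k 0); apply: ge0_le_integral => //.
  - by move=> w _; rewrite lee_fin powR_ge0.
  - exact: (measurableT_comp mKa (iid_measurable eps_iid 0)).
  - move=> w _; rewrite /arch_kappa -fine_poweR.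
    have := poweR_ge0 (arch_K b (eps 0 w)) alpha.
    by case: (_ `^ _)%E => [r| |]//= _; rewrite leey.
have ge0 : (0 <= \int[P]_w (arch_kappa (eps 0 w) `^ alpha)%:E)%E.
  by apply: integral_ge0 => w _; rewrite lee_fin powR_ge0.
exists (fine (\int[P]_w (arch_kappa (eps 0 w) `^ alpha)%:E)%E).
  by rewrite -lte_fin fineK// ge0_fin_numE// (lt_trans lt1)// ltry.
by rewrite fineK// ge0_fin_numE// (lt_trans lt1)// ltry.
Qed.

Definition noise_path (w : T) : int -> L2 R := fun k => eps k w.

(** What the estimates along one noise sequence require, for all times at once. It holds almost
    surely since the times are countable. *)
Definition good_path (w : T) : Prop :=
  (forall k, (sqK b (fun s => L2_eval (noise_path w k, s)) <=
     (arch_kappa (noise_path w k) ^+ 2)%:E)%E) /\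
  (forall k, exists C q : R, [/\ 0 <= C, 0 <= q, q < 1 &
     forall n, \prod_(i < n) arch_kappa (noise_path w (k - 1 - i%:Z)) <= C * q ^+ n]).

Lemma ae_good_path : {ae P, forall w, good_path w}.
Proof.
have [rho rho1 rhoE] := arch_kappa_moment.
have h1 : {ae P, forall w, forall k, (arch_K b (eps k w) < +oo)%E}.
  by apply: ae_forall_int => k; exact: arch_K_lty.
have h2 := ae_forall_int
  (kprod_geometric eps_iid measurable_arch_kappa arch_kappa_ge0 alpha_gt0 rhoE rho1).
apply: filterS2 h1 h2 => w w1 w2; split => k; last exact: w2.
by apply: sqK_arch_K => //; exact: w1.
Qed.

Definition arch_g (f : nat -> L2 R) : L2 R :=
  mkL2 (fun t => fine (vol_lim b delta f t)).

Definition arch_v (k : int) (w : T) : L2 R := arch_g (fun j => eps (k - 1 - j%:Z) w).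

Notation SeqL2 := (g_sigma_algebraType (@cylinders nat _ (L2 R))).

Lemma measurable_arch_g : measurable_fun setT (arch_g : SeqL2 -> L2 R).
Proof.
apply: (@measurable_mkL2 R _ SeqL2 (fun ft => fine (vol_lim b delta ft.1 ft.2))).
exact: (measurableT_comp _ (measurable_vol_lim mb delta)).
Qed.

Lemma measurable_functional_arch_g : measurable_functional arch_g.
Proof.
by move=> B mB; have := measurable_arch_g measurableT mB; rewrite setTI.
Qed.

Lemma measurable_arch_v k : measurable_fun setT (arch_v k).
Proof.
move=> _ B mB; rewrite setTI.
apply: (@measurable_cylinder_map _ _ T (L2 R) nat (fun j w => eps (k - 1 - j%:Z) w) _
  (arch_g @^-1` B)); last exact: measurable_functional_arch_g.
by move=> j; exact: (iid_measurable eps_iid).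
Qed.

Lemma good_path_sol w : good_path w -> path_sol b delta (noise_path w) (arch_v ^~ w).
Proof.
move=> [h1 h2]; apply: (@path_vol_sol R b delta delta_ge0 b_bounded (noise_path w)
  (fun k => arch_kappa (noise_path w k))) => //.
by move=> k; exact: arch_kappa_ge0.
Qed.

Lemma volatility_arch_v : volatility_ARCH1 P eps delta b arch_v.
Proof.
split=> [k|k]; first exact: measurable_arch_v.
apply: filterS ae_good_path => w gw.
have sv := good_path_sol gw.
split; [exact: sv.1|by apply: aeW|].
by have /(path_solP delta_ge0 b_ge0 b_bounded (noise_path w) sv.1) := sv; exact.
Qed.

Lemma volatility_path_sol v : volatility_ARCH1 P eps delta b v ->
  {ae P, forall w, path_sol b delta (noise_path w) (v ^~ w)}.
Proof.
move=> [_ /ae_forall_int vE]; apply: filterS vE => w vE.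
apply/path_solP => // k; first by have [] := vE k.
by have [] := vE k.
Qed.

(** Only the law of the norm of [v k] has to be constant in [k]. Stationarity of [v] gives this, and
    so does stationarity of [y]. *)
Lemma arch_v_unique_of_tight v :
  (forall k, measurable_fun setT (v k)) ->
  {ae P, forall w, path_sol b delta (noise_path w) (v ^~ w)} ->
  (forall (M : R) k, P [set w | (M%:E <= sqint (v k w))%E] =
                     P [set w | (M%:E <= sqint (v 0%R w))%E]) ->
  forall k, {ae P, forall w, v k w = arch_v k w}.
Proof.
move=> mv sv tight k.
have [rho rho1 rhoE] := arch_kappa_moment.
have mev (u : T -> L2 R) : measurable_fun setT u -> measurable_fun setT
    (fun wt : T * measurableTypeR R => L2_eval (u wt.1, wt.2)).
  move=> mu; have m2 : measurable_fun setT (fun wt : T * measurableTypeR R => (u wt.1, wt.2)).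
    by apply: measurable_fun_pair => //; exact: (measurableT_comp mu).
  exact: (measurableT_comp (@measurable_L2_eval R) m2).
have mN j : measurable_fun setT (fun w => sqint (v j w)).
  exact: (measurableT_comp (@measurable_sqint_L2 R) (mv j)).
pose D w := (\int[leb01 R]_t ((v k w t - arch_v k w t) ^+ 2)%:E)%E.
have mD : measurable_fun setT D.
  (* The integrand of [D] uses chosen representatives; [L2_eval] makes it jointly measurable without
     changing the integral. *)
  rewrite (_ : D = fun w => sqint (fun t => L2_eval (v k w, t) - L2_eval (arch_v k w, t))).
    apply: (@measurable_sqint R _ T (fun wt => L2_eval (v k wt.1, wt.2) - L2_eval (arch_v k wt.1, wt.2))).
    by apply: measurable_funB; apply: mev => //; exact: measurable_arch_v.
  apply/funext => w; apply: ae01_eq_integral.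
  - by apply/measurable_EFinP/measurable_funX/measurable_funB; exact: measurable_L2.
  - by apply/measurable_EFinP/measurable_funX/measurable_funB; exact: measurable_eval.
  - by apply: ae01S2 (L2_evalE (v k w)) (L2_evalE (arch_v k w)) => t -> ->.
have D0 : {ae P, forall w, D w = 0%E}.
  apply: (@vanish_in_probability _ _ _ P D (fun n w => kprod eps arch_kappa k n w ^+ 2)
    (fun n w => sqint (v (k - n%:Z) w))) => //.
  - by move=> n; apply: measurable_funX; exact: (measurable_kprod eps_iid measurable_arch_kappa).
  - by move=> w; apply: integral_ge0 => t _; rewrite lee_fin sqr_ge0.
  - by move=> n w; exact: sqr_ge0.
  - by move=> n w; apply: integral_ge0 => t _; rewrite lee_fin sqr_ge0.
  - move=> n; apply: filterS2 ae_good_path sv => w [g1 g2] svw.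
    apply: (@path_unique_bound R b delta delta_ge0 b_bounded (noise_path w)
      (fun k => arch_kappa (noise_path w k)) _ _ _ (v ^~ w)) => //.
    by move=> j; exact: arch_kappa_ge0.
  - move=> r eta r0 eta0.
    exact: (kprod_small eps_iid measurable_arch_kappa arch_kappa_ge0 alpha_gt0 rhoE rho1).
  - move=> eta eta0.
    have [M M0 hM] := tight_lty P (mN 0) (fun w => finite_L2 (v 0 w)) eta0.
    by exists M => // n; rewrite tight; exact: ltW.
apply: filterS D0 => w Dw; apply: L2_ext.
have md : measurable_fun setT (fun t => ((v k w t - arch_v k w t) ^+ 2)%:E).
  by apply/measurable_EFinP/measurable_funX/measurable_funB; exact: measurable_L2.
have : (\int[leb01 R]_t `|((v k w t - arch_v k w t) ^+ 2)%:E| = 0)%E.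
  by rewrite -Dw; apply: eq_integral => t _; rewrite gee0_abs// lee_fin sqr_ge0.
move=> /(ae_eq_integral_abs _ measurableT md); apply: ae01S => t /(_ I) /= [] /eqP.
by rewrite sqrf_eq0 subr_eq0 => /eqP.
Qed.

End arch_process.

(** * The observed process *)

Section arch_observed.
Context (R : realType) (d : measure_display) (T : measurableType d)
  (P : probability T R) (eps : int -> T -> L2 R) (delta : L2 R)
  (b : R -> R -> R) (alpha : R).
Hypothesis eps_iid : iid P eps.
Hypothesis delta_ge0 : L2_nonneg delta.
Hypothesis b_ge0 : nonneg_kernel_op b.
Hypothesis b_bounded : bounded_kernel_op b.
Hypothesis alpha_gt0 : 0 < alpha.
Hypothesis K_moment : (\int[P]_w (arch_K b (eps 1%R w) `^ alpha) < 1)%E.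
Let mb := b_bounded.1.

Notation arch_v := (arch_v eps delta b).
Notation SeqL2 := (g_sigma_algebraType (@cylinders nat _ (L2 R))).

(** Builds [y] from [(eps, sigma^2)] as a measurable map on all pairs; [mkL2] returns 0 where the
    product leaves L2. *)
Definition scale_sqrt (x : L2 R * L2 R) : L2 R :=
  mkL2 (fun s => L2_eval (x.1, s) * Num.sqrt (L2_eval (x.2, s))).

Lemma measurable_scale_sqrt_fun (x : L2 R * L2 R) :
  measurable_fun setT (fun s => L2_eval (x.1, s) * Num.sqrt (L2_eval (x.2, s))).
Proof.
apply: measurable_funM; first exact: measurable_eval.
by apply: measurableT_comp; [exact: measurable_sqrtr|exact: measurable_eval].
Qed.

Lemma measurable_scale_sqrt : measurable_fun setT scale_sqrt.
Proof.
have mev (p : L2 R * L2 R -> L2 R) : measurable_fun setT p -> measurable_fun setT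
    (fun xs : (L2 R * L2 R) * measurableTypeR R => L2_eval (p xs.1, xs.2)).
  move=> mp.
  have m2 : measurable_fun setT (fun xs : (L2 R * L2 R) * measurableTypeR R => (p xs.1, xs.2)).
    by apply: measurable_fun_pair => //; exact: (measurableT_comp mp).
  exact: (measurableT_comp (@measurable_L2_eval R) m2).
apply: (@measurable_mkL2 R _ _
  (fun xs => L2_eval (xs.1.1, xs.2) * Num.sqrt (L2_eval (xs.1.2, xs.2)))).
apply: measurable_funM; first exact: (mev fst).
exact: (measurableT_comp (@measurable_sqrtr R) (mev snd measurable_snd)).
Qed.

(** Noise and volatility at time [k] are together one functional of the noise up to [k]. The map [h]
    is the identity for the joint process and [scale_sqrt] for [y]. *)
Lemma stationary_pair (d' : measure_display) (Z : measurableType d')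
    (h : L2 R * L2 R -> Z) : measurable_fun setT h ->
  strictly_stationary P (fun k w => h (eps k w, arch_v k w)).
Proof.
move=> mh; pose Psi (f : nat -> L2 R) := h (f 0%N, arch_g delta b (shiftf f)).
have -> : (fun k w => h (eps k w, arch_v k w)) =
    (fun k w => Psi (fun j => eps (k - j%:Z) w)).
  apply/funext => k; apply/funext => w; rewrite /Psi /arch_v subr0.
  congr (h (_, arch_g _ _ _)); apply/funext => j; rewrite /shiftf.
  by rewrite intS opprD addrA.
apply: strictly_stationary_functional => // B mB.
have mPsi : measurable_fun setT (Psi : SeqL2 -> Z).
  apply: (measurableT_comp mh); apply: measurable_fun_pair.
    exact: measurable_seq_coord.
  exact: (measurableT_comp (measurable_arch_g delta b_bounded) (@measurable_shiftf R)).
by have := mPsi measurableT B mB; rewrite setTI.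
Qed.

Lemma stationary_marginal (d' : measure_display) (Z : measurableType d')
    (z : int -> T -> Z) (A : set Z) k : measurable A -> strictly_stationary P z ->
  P [set w | A (z k w)] = P [set w | A (z 0 w)].
Proof.
move=> mA /(_ k [set f | A (f 0)]); rewrite /= add0r; apply.
by apply: sub_sigma_algebra; exists 0, A.
Qed.

Lemma volatility_unique v : volatility_ARCH1 P eps delta b v ->
  strictly_stationary P v -> forall k, {ae P, forall w, v k w = arch_v k w}.
Proof.
move=> hv sv.
apply: (arch_v_unique_of_tight eps_iid delta_ge0 b_bounded alpha_gt0 K_moment).
- exact: hv.1.
- exact: volatility_path_sol.
move=> M k; apply: (@stationary_marginal _ _ v [set x | (M%:E <= sqint x)%E]) => //.
rewrite -[X in measurable X]setTI; apply: emeasurable_fun_c_infty => //.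
exact: measurable_sqint_L2.
Qed.

(* The squared norm of [sigma_k^2] as a function of [y_(k-1)], through which
   stationarity of [y] alone controls the law of the norm of [sigma_k^2]. *)
Definition next_sqnorm (x : L2 R) : \bar R :=
  sqnorm (fun t => ((delta_pos delta t)%:E +
    arch_op b (cst 1%R) (fun s => (L2_eval (x, s) ^+ 2)%:E) t)%E).

Lemma measurable_next_sqnorm : measurable_fun setT next_sqnorm.
Proof.
have m1 : measurable_fun setT (fun xt : L2 R * measurableTypeR R =>
    ((delta_pos delta xt.2)%:E +
      arch_op b (cst 1%R) (fun s => (L2_eval (xt.1, s) ^+ 2)%:E) xt.2)%E).
  apply: emeasurable_funD.
    apply/measurable_EFinP.
    exact: (measurableT_comp (measurable_delta_pos delta)).
  apply: (measurable_arch_op_par mb (e := cst 1%R)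
    (u := fun xs : L2 R * measurableTypeR R => (L2_eval xs ^+ 2)%:E)).
  - exact: measurable_cst.
  - by apply/measurable_EFinP/measurable_funX; exact: measurable_L2_eval.
  - by move=> x; rewrite lee_fin sqr_ge0.
apply: (@measurable_integral01 R _ (L2 R) (fun xt => (((delta_pos delta xt.2)%:E +
      arch_op b (cst 1%R) (fun s => (L2_eval (xt.1, s) ^+ 2)%:E) xt.2) *
      ((delta_pos delta xt.2)%:E +
      arch_op b (cst 1%R) (fun s => (L2_eval (xt.1, s) ^+ 2)%:E) xt.2))%E)).
  exact: emeasurable_funM.
have s0 (xt : L2 R * measurableTypeR R) : (0 <= (delta_pos delta xt.2)%:E +
      arch_op b (cst 1%R) (fun s => (L2_eval (xt.1, s) ^+ 2)%:E) xt.2)%E.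
  rewrite adde_ge0 ?lee_fin ?delta_pos_ge0//.
  by apply: arch_op_ge0 => s; rewrite lee_fin sqr_ge0.
by move=> xt; exact: mule_ge0.
Qed.

Lemma sqint_next (x y : L2 R) :
  {ae leb01 R, forall t, (x t)%:E =
    ((delta t)%:E + kernel_op b (fun s => y s ^+ 2)%R t)%E} ->
  sqint x = next_sqnorm y.
Proof.
move=> xE.
have m0 : measurable_fun setT (fun s => (L2_eval (y, s) ^+ 2)%:E).
  by apply/measurable_EFinP/measurable_funX; exact: measurable_eval.
have mop : measurable_fun setT (fun t => ((delta_pos delta t)%:E +
    arch_op b (cst 1%R) (fun s => (L2_eval (y, s) ^+ 2)%:E) t)%E).
  apply: emeasurable_funD; first by apply/measurable_EFinP; exact: measurable_delta_pos.
  by apply: measurable_arch_op => // s; rewrite lee_fin sqr_ge0.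
have kE : {ae leb01 R, forall t, kernel_op b (fun s => y s ^+ 2) t =
    arch_op b (cst 1%R) (fun s => (L2_eval (y, s) ^+ 2)%:E) t}.
  apply: (@kernel_op_arch_op R b mb b_ge0 b_bounded (cst 1%R) (fun s => y s ^+ 2)) => //.
  - by apply: measurable_funX; exact: measurable_L2.
  - by apply: measurable_funX; exact: measurable_L2.
  - by apply: aeW => s; rewrite expr1n mul1r.
  - by apply: ae01S (L2_evalE y) => s ->.
apply: ae01_eq_integral.
- by apply/measurable_EFinP/measurable_funX; exact: measurable_L2.
- exact: emeasurable_funM.
- apply: ae01S3 xE kE (ae_delta_pos delta_ge0) => t h1 h2 h3.
  by rewrite h3 -h2 -h1 -EFinM -expr2.
Qed.

Lemma functional_volatility y v : functional_ARCH1 P eps delta b y v ->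
  volatility_ARCH1 P eps delta b v.
Proof.
move=> [my mv eqs]; split => // k.
apply: filterS2 (eqs k) (eqs (k - 1)) => w [v0 _ vE] [_ yE _].
split => //; first exact: aeW.
by apply: ae01S vE => t ->; rewrite (kernel_op_sqr_ae b_bounded t yE).
Qed.

Lemma functional_unique y v : functional_ARCH1 P eps delta b y v ->
  strictly_stationary P y -> forall k, {ae P, forall w, v k w = arch_v k w}.
Proof.
move=> fyv sy.
have hv := functional_volatility fyv.
have [my mv eqs] := fyv.
apply: (arch_v_unique_of_tight eps_iid delta_ge0 b_bounded alpha_gt0 K_moment) => //.
  exact: volatility_path_sol.
move=> M.
have mA : measurable [set x : L2 R | (M%:E <= next_sqnorm x)%E].
  rewrite -[X in measurable X]setTI; apply: emeasurable_fun_c_infty => //.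
  exact: measurable_next_sqnorm.
(* The norm of [v k] is almost surely a function of [y (k - 1)], whose law is that of [y 0]; the
   right side is free of [k]. *)
have step k : P [set w | (M%:E <= sqint (v k w))%E] = P [set w | (M%:E <= next_sqnorm (y 0%R w))%E].
  rewrite -(stationary_marginal (k - 1) mA sy); apply: probability_ae_eq.
  - rewrite -[X in measurable X]setTI; apply: emeasurable_fun_c_infty => //.
    exact: (measurableT_comp (@measurable_sqint_L2 R) (mv k)).
  - by rewrite -[X in measurable X]setTI; exact: my.
  - by apply: filterS (eqs k) => w [_ _ /sqint_next vE]; rewrite /= vE.
by move=> k; exact: (etrans (step k) (esym (step 0))).
Qed.

Definition arch_y (k : int) (w : T) : L2 R := scale_sqrt (eps k w, arch_v k w).

(** Minimality gives [arch_v <= v0], hence [eps^2 arch_v <= eps^2 v0 = y0^2]. So the product is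
    square integrable, and [scale_sqrt] did not fall back on 0. *)
Lemma functional_arch_y y0 v0 : functional_ARCH1 P eps delta b y0 v0 ->
  functional_ARCH1 P eps delta b arch_y arch_v.
Proof.
move=> f0; have hv0 := functional_volatility f0.
have mv := measurable_arch_v delta eps_iid b_bounded.
split=> // k.
  apply: (measurableT_comp measurable_scale_sqrt); apply: measurable_fun_pair.
    exact: (iid_measurable eps_iid).
  exact: mv.
have gp := ae_good_path eps_iid b_bounded alpha_gt0 K_moment.
have sol0 := volatility_path_sol delta_ge0 b_ge0 b_bounded hv0.
have yE : {ae P, forall w, forall j,
    {ae leb01 R, forall s, arch_y j w s = eps j w s * Num.sqrt (arch_v j w s)}}.
  apply: ae_forall_int => j.
  have [_ _ eqs0] := f0.
  apply: filterS3 gp sol0 (eqs0 j) => w gw s0 [v00 y0E _].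
  have le0 : {ae leb01 R, forall t, (ppart (arch_v j w) t <= ppart (v0 j w) t)%E}.
    have [g1 g2] := gw.
    apply: (@path_vol_le R b delta delta_ge0 b_bounded (noise_path eps w)
      (fun k => arch_kappa b (noise_path eps w k)) _ g1 g2 (v0 ^~ w)) => //.
    by move=> i; exact: arch_kappa_ge0.
  have v_ge0 := (good_path_sol delta_ge0 b_bounded gw).1 j.
  have mm := measurable_scale_sqrt_fun (eps j w, arch_v j w).
  have ev : {ae leb01 R, forall s,
      L2_eval (eps j w, s) * Num.sqrt (L2_eval (arch_v j w, s)) =
      eps j w s * Num.sqrt (arch_v j w s)}.
    by apply: ae01S2 (L2_evalE (eps j w)) (L2_evalE (arch_v j w)) => s -> ->.
  apply: (ae01S2 _ (mkL2E mm _) ev) => [s h1 h2|]; first by rewrite -h2 -h1.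
  apply: le_lt_trans (finite_L2 (y0 j w)); apply: ae_ge0_le_integral => //.
  - by move=> s _; rewrite lee_fin sqr_ge0.
  - exact/measurable_EFinP/measurable_funX.
  - by move=> s _; rewrite lee_fin sqr_ge0.
  - by apply/measurable_EFinP/measurable_funX; exact: measurable_L2.
  have le1 : {ae leb01 R, forall s, arch_v j w s <= v0 j w s}.
    apply: ae01S3 le0 v_ge0 v00 => s + h1 h2.
    by rewrite /ppart lee_fin !max_l.
  apply: ae01S3 (ae01S2 (fun s h1 h2 => conj h1 h2) ev y0E) v_ge0 le1.
  move=> s [-> ->] h1 h2 _; rewrite lee_fin !exprMn ler_wpM2l ?sqr_ge0//.
  by rewrite !sqr_sqrtr// (le_trans h1).
have [_ vol] := volatility_arch_v eps_iid delta_ge0 b_ge0 b_bounded alpha_gt0 K_moment.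
apply: filterS2 yE (vol k) => w yE [v0k _ vE].
split => //.
by apply: ae01S vE => t ->; rewrite (kernel_op_sqr_ae b_bounded t (yE (k - 1))).
Qed.

End arch_observed.

Theorem theorem2p1 (R : realType) (d : measure_display) (T : measurableType d)
    (P : probability T R) (eps : int -> T -> L2 R) (delta : L2 R)
    (b : R -> R -> R) (alpha : R)
    (eps_iid : iid P eps)
    (delta_ge0 : L2_nonneg delta)
    (b_ge0 : nonneg_kernel_op b)
    (b_bounded : bounded_kernel_op b)
    (alpha_gt0 : 0 < alpha)
    (K_moment : (\int[P]_w (arch_K b (eps 1%R w) `^ alpha) < 1)%E) :
  exists (g : (nat -> L2 R) -> L2 R) (v : int -> T -> L2 R),
    [/\ measurable_functional g,
        forall k, {ae P, forall w, v k w = g (fun j => eps (k - 1 - j%:Z) w)},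
        [/\ volatility_ARCH1 P eps delta b v,
            strictly_stationary P (fun k w => (eps k w, v k w)) &
            forall v', volatility_ARCH1 P eps delta b v' ->
              strictly_stationary P v' ->
              forall k, {ae P, forall w, v' k w = v k w}] &
        forall y0 v0, functional_ARCH1 P eps delta b y0 v0 ->
          exists y : int -> T -> L2 R,
            [/\ functional_ARCH1 P eps delta b y v,
                strictly_stationary P y &
                forall y' v', functional_ARCH1 P eps delta b y' v' ->
                  strictly_stationary P y' ->
                  forall k, {ae P, forall w,
                    y' k w = y k w /\ v' k w = v k w}]].
Proof.
exists (arch_g delta b), (arch_v eps delta b); split.
- exact: measurable_functional_arch_g.
- by move=> k; exact: aeW.
- split.
  + exact: (volatility_arch_v eps_iid delta_ge0 b_ge0 b_bounded alpha_gt0 K_moment).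
  + have mid : measurable_fun setT (@id (L2 R * L2 R)%type) by exact: measurable_id.
    exact: (stationary_pair delta eps_iid b_bounded mid).
  + move=> v' hv' sv'.
    exact: (volatility_unique eps_iid delta_ge0 b_ge0 b_bounded alpha_gt0 K_moment hv' sv').
move=> y0 v0 f0; exists (arch_y eps delta b).
have fy := functional_arch_y eps_iid delta_ge0 b_ge0 b_bounded alpha_gt0 K_moment f0.
split; first exact: fy.
  exact: (stationary_pair delta eps_iid b_bounded (@measurable_scale_sqrt R)).
move=> y' v' f' s' k.
have vv := functional_unique eps_iid delta_ge0 b_ge0 b_bounded alpha_gt0 K_moment f' s' k.
have [_ _ eqs] := fy; have [_ _ eqs'] := f'.
apply: filterS3 vv (eqs k) (eqs' k) => w vw [_ yE _] [_ yE' _]; split => //.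
apply: L2_ext; apply: ae01S2 yE yE' => s -> ->.
by rewrite vw.
Qed.
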